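(* Let $d,p\ge1$ be integers, let $w:\mathbb{R}^{d\times p}\to[0,\infty)$ be a Lebesgue-measurable probability density function, let $P$ and $P_0$ be probability distributions on $\mathbb{R}^{d\times p}$, and let $X_1,X_2,\ldots$ be independent random matrices in $\mathbb{R}^{d\times p}$, each with distribution $P$. Let $D_n$ (computed from $X_1,\ldots,X_n$ and $P_0$) be as defined in the context. (i) If $P=P_0$, then $D_n\to0$ almost surely as $n\to\infty$. (ii) If $w$ is positive almost everywhere and $P\ne P_0$, then $D_n\to c$ almost surely as $n\to\infty$ for some constant $c$ with $0<c\le4$.
   Context: For $t\in\mathbb{R}^{d\times p}$ let $\varphi_0(t)=\int\exp(\mathrm{i}\,\mathrm{tr}(t'x))\,\mathrm{d}P_0(x)$ be the characteristic function of $P_0$ and $\varphi_n(t)=\frac1n\sum_{j=1}^n\exp(\mathrm{i}\,\mathrm{tr}(t'X_j))$ the empirical characteristic function ($M'$ denotes the transpose of $M$). The test statistic is $$D_n=\int_{\mathbb{R}^{d\times p}}|\varphi_n(t)-\varphi_0(t)|^2w(t)\,\mathrm{d}t.$$ *)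

(* Defs.v *)
From HB Require Import structures.
From mathcomp Require Import all_boot all_order all_algebra finmap.
From mathcomp Require Import complex.
From mathcomp Require Import all_classical all_reals all_analysis.

Set Implicit Arguments.
Unset Strict Implicit.
Unset Printing Implicit Defensive.

Import Order.TTheory GRing.Theory Num.Theory.
Import numFieldNormedType.Exports.

Local Open Scope classical_set_scope.
Local Open Scope ring_scope.

(* Random matrices and their laws live on the Borel sigma-algebra. *)
Definition borel_mx (R : realType) (d p : nat) :=
  g_sigma_algebraType (@open 'M[R]_(d, p)).

HB.instance Definition _ (R : realType) (d p : nat) :=
  Measurable.copy (borel_mx R d p)
    (g_sigma_algebraType (@open 'M[R]_(d, p))).

Section lebesgue_outer_measure.
Variables (R : realType) (d p : nat).
Local Notation M := 'M[R]_(d, p).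

Definition box (a b : M) : set M :=
  [set x | forall i j, a i j < x i j <= b i j].

Definition box_volume (a b : M) : R :=
  \prod_(i < d) \prod_(j < p) Num.max 0 (b i j - a i j).

(* The family (box a_k b_k) for k in D is a countable, possibly finite or
   empty, cover of A. *)
Definition box_cover (A : set M) : set (set nat * (nat -> M * M)) :=
  [set DB | A `<=` \bigcup_(k in DB.1)
                     box (DB.2 k).1 (DB.2 k).2].

Definition lebesgue_outer (A : set M) : \bar R :=
  ereal_inf [set (\sum_(k <oo | k \in DB.1)
                    (box_volume (DB.2 k).1 (DB.2 k).2)%:E)%E
            | DB in box_cover A].

Lemma box_volume_ge0 a b : 0 <= box_volume a b.
Proof.
by apply: prodr_ge0 => i _; apply: prodr_ge0 => j _; rewrite le_max lexx.
Qed.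

Local Open Scope ereal_scope.

Lemma lebesgue_outer_ge0 A : 0 <= lebesgue_outer A.
Proof.
apply: le_ereal_inf_tmp => _ [DB _ <-].
by apply: nneseries_ge0 => k _ _; rewrite lee_fin box_volume_ge0.
Qed.

Lemma lebesgue_outer0 : lebesgue_outer set0 = 0.
Proof.
apply/eqP; rewrite eq_le lebesgue_outer_ge0 andbT.
apply: ereal_inf_lbound; exists (set0, fun=> (0%R, 0%R)) => //=.
by rewrite eseries0// => k _; rewrite in_set0.
Qed.

Lemma le_lebesgue_outer : {homo lebesgue_outer : A B / A `<=` B >-> A <= B}.
Proof.
move=> A B AB; apply/ereal_inf_le_tmp => _ [DB cB <-].
by exists DB => //; exact: subset_trans cB.
Qed.

Lemma lebesgue_outer_sigma_subadditive : sigma_subadditive lebesgue_outer.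
Proof.
move=> A; have [[i ioo]|] := pselect (exists i, lebesgue_outer (A i) = +oo).
  rewrite (eseries_pinfty _ _ ioo) ?leey// => n _.
  by rewrite -ltNye (lt_le_trans _ (lebesgue_outer_ge0 _)).
rewrite -forallNE => Aoo.
suff add2e (e : {posnum R}) : lebesgue_outer (\bigcup_n A n) <=
    \sum_(i <oo) lebesgue_outer (A i) + e%:num%:E.
  by apply/lee_addgt0Pr => _/posnumP[].
rewrite (le_trans _ (epsilon_trick _ _ _))//; last first.
  by move=> n; exact: lebesgue_outer_ge0.
pose vol (DB : set nat * (nat -> M * M)) k : \bar R :=
  if k \in DB.1 then (box_volume (DB.2 k).1 (DB.2 k).2)%:E else 0.
have vol_ge0 DB k : 0 <= vol DB k.
  by rewrite /vol; case: ifP => // _; rewrite lee_fin box_volume_ge0.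
pose P n DB := box_cover (A n) DB /\
  \sum_(k <oo) vol DB k <= lebesgue_outer (A n) + (e%:num / (2 ^ n.+1)%:R)%:E.
have [G PG] : {G & forall n, P n (G n)}.
  apply: (@choice _ _ P) => n; rewrite /P.
  have en1 : (0 < e%:num / (2 ^ n.+1)%:R :> R)%R by [].
  have An : lebesgue_outer (A n) \is a fin_num.
    rewrite fin_numE; apply/andP; split; last exact/eqP.
    by rewrite -ltNye (lt_le_trans _ (lebesgue_outer_ge0 _)).
  have [_ [DB cDB <-] xS] := lb_ereal_inf_adherent en1 An.
  exists DB; split => //; rewrite /vol.
  by rewrite [leLHS](_ : _ = \sum_(k <oo | k \in DB.1)
     (box_volume (DB.2 k).1 (DB.2 k).2)%:E) ?ltW// [RHS]eseries_mkcond.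
pose v (ij : nat * nat) := vol (G ij.1) ij.2.
have v_ge0 x : 0 <= v x by exact: vol_ge0.
apply: (@le_trans _ _ (\esum_(ij in setT) v ij)).
  have /card_esym/ppcard_eqP[f] := card_nat2.
  apply: ereal_inf_lbound => /=.
  exists ([set k | (G (f k).1).1 (f k).2],
          fun k => (G (f k).1).2 (f k).2).
    move=> t [i _ /(PG i).1[j /= jD Bj]].
    by exists (f^-1%FUN (i, j)); rewrite /= ?inE invK ?inE.
  rewrite (_ : esum _ _ = \sum_(k <oo) v (f k)); last first.
    rewrite -(esum_pred_image v f xpredT)//; last first.
      by move=> i j _ _; apply: inj; rewrite inE.
    congr esum; apply/seteqP; split=> // x _.
    by exists (f^-1%FUN x) => //; rewrite invK ?inE.
  rewrite eseries_mkcond; apply: eq_eseriesr => k _.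
  by rewrite /v /vol.
rewrite (_ : esum _ _ = \sum_(i <oo) \sum_(j <oo) v (i, j)); last first.
  pose J : nat -> set (nat * nat) := fun i => [set (i, j) | j in setT].
  rewrite (_ : setT = \bigcup_k J k); last first.
    by rewrite predeqE => -[a b]; split => // _; exists a => //; exists b.
  rewrite esum_bigcupT /=; last 2 first.
    - apply/trivIsetP => i j _ _ ij.
      rewrite predeqE => -[n m] /=; split => //= -[] [_] _ [<-{n} _].
      by move=> [m' _] [] /esym/eqP; rewrite (negbTE ij).
    - by move=> /= ?.
  rewrite -(image_id [set: nat]) -fun_true esum_pred_image//; last first.
    by move=> n _; exact: esum_ge0.
  apply: eq_eseriesr => /= j _.
  rewrite -(esum_pred_image v (pair j) predT)//=; last first.
    by move=> ? ? _ _; exact: (@can_inj _ _ _ snd).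
  by congr esum; rewrite predeqE => -[a b]; split; move=> [i _ <-]; exists i.
apply: lee_nneseries => [i _ _|i _]; last exact: (PG i).2.
exact: nneseries_ge0.
Qed.

HB.instance Definition _ := isOuterMeasure.Build R M lebesgue_outer
  lebesgue_outer0 lebesgue_outer_ge0 le_lebesgue_outer
  lebesgue_outer_sigma_subadditive.

End lebesgue_outer_measure.

(* Matrices with the (complete) sigma-algebra of Lebesgue-measurable sets,
   in the sense of Caratheodory. *)
Definition lebesgue_mx (R : realType) (d p : nat) :=
  caratheodory_type (@lebesgue_outer R d p).

HB.instance Definition _ (R : realType) (d p : nat) :=
  Measurable.copy (lebesgue_mx R d p)
    (caratheodory_type (@lebesgue_outer R d p)).

Definition lebesgue_mx_measure (R : realType) (d p : nat) :
  set (lebesgue_mx R d p) -> \bar R := @lebesgue_outer R d p.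

HB.instance Definition _ (R : realType) (d p : nat) :=
  isMeasure.Build _ (lebesgue_mx R d p) R (@lebesgue_mx_measure R d p)
    (@caratheodory_measure0 _ _ (@lebesgue_outer R d p))
    (@caratheodory_measure_ge0 _ _ (@lebesgue_outer R d p))
    (@caratheodory_measure_sigma_additive _ _ (@lebesgue_outer R d p)).

Definition is_lebesgue_density (R : realType) (d p : nat)
    (w : 'M[R]_(d, p) -> R) : Prop :=
  [/\ measurable_fun [set: lebesgue_mx R d p] (w : lebesgue_mx R d p -> R),
      forall t, 0 <= w t &
      (\int[@lebesgue_mx_measure R d p]_t (w t)%:E = 1)%E].

(* Equality of measures cannot be Leibniz equality: the value of a measure on
   non-measurable sets is unconstrained. *)
Definition same_law (R : realType) (d : measure_display)
    (T : measurableType d) (mu nu : set T -> \bar R) : Prop :=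
  forall A, measurable A -> mu A = nu A.

Definition mutually_independent (R : realType) (d d' : measure_display)
    (Omega : measurableType d) (T : measurableType d')
    (Pr : probability Omega R) (X : nat -> {RV Pr >-> T}) : Prop :=
  forall (J : {fset nat}) (A : nat -> set T), (forall j, measurable (A j)) ->
    Pr (\bigcap_(j in [set` J]) (X j @^-1` A j)) =
    (\prod_(j <- J) Pr (X j @^-1` A j))%E.

Definition expi (R : realType) (x : R) : R[i] := Complex (cos x) (sin x).

Definition Cintegral (R : realType) (d : measure_display)
    (T : measurableType d) (mu : {measure set T -> \bar R})
    (f : T -> R[i]) : R[i] :=
  Complex (\int[mu]_x complex.Re (f x)) (\int[mu]_x complex.Im (f x)).

Definition char_fun (R : realType) (d p : nat)
    (P : probability (borel_mx R d p) R) (t : 'M[R]_(d, p)) : R[i] :=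
  Cintegral P (fun x : borel_mx R d p =>
    expi (\tr (t^T *m (x : 'M[R]_(d, p))))).

(* The sample X_1, ..., X_n of the text is x 0, ..., x n.-1. *)
Definition emp_char_fun (R : realType) (d p : nat) (n : nat)
    (x : nat -> 'M[R]_(d, p)) (t : 'M[R]_(d, p)) : R[i] :=
  n%:R^-1 * \sum_(j < n) expi (\tr (t^T *m x j)).

Definition test_stat (R : realType) (d p : nat) (w : 'M[R]_(d, p) -> R)
    (P0 : probability (borel_mx R d p) R) (x : nat -> 'M[R]_(d, p))
    (n : nat) : \bar R :=
  (\int[@lebesgue_mx_measure R d p]_t
    (ComplexField.Normc.normc (emp_char_fun n x t - char_fun P0 t) ^+ 2
     * w t)%:E)%E.

(* Main.v *)
Require Import Defs.
From HB Require Import structures.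
From mathcomp Require Import all_boot all_order all_algebra finmap complex.
From mathcomp Require Import all_classical all_reals all_analysis measurable_realfun.
From mathcomp Require Import ring lra zify.

Import Order.TTheory GRing.Theory Num.Theory.
Import numFieldNormedType.Exports.

Set Implicit Arguments.
Unset Strict Implicit.

Local Open Scope classical_set_scope.
Local Open Scope ring_scope.

(**
  The frequencies with which the sample visits the cubes of mesh 1/m converge
  almost surely, for all (countably many) cubes at once: this is the strong law
  for pairwise independent events, obtained from the second moments along the
  squares.  Since x |-> exp(i tr(t'x)) oscillates little on small cubes, almost
  surely the empirical characteristic function converges to that of P at every
  t simultaneously, and dominated convergence gives
  D_n --> c := \int |phi - phi_0|^2 w.

  If c = 0, then phi = phi_0 almost everywhere, hence everywhere: {phi <> phi_0}
  is open, and a nonempty open set is not null, for otherwise its countably many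
  rational translates would make the whole space null, contradicting
  \int w = 1.  Uniqueness of characteristic functions then gives P = P_0.

  For uniqueness, call f a multiplier if multiplication by f preserves the
  property "for all s, P and Q give the same integral to g(x) exp(i tr(s'x))" of
  g.  Multipliers form an algebra that is closed under bounded pointwise limits
  and contains cos(tr(t'x)) and sin(tr(t'x)).  Iterating u |-> (3u - u^3)/2 at
  sin((x_ij - a)/n) and then letting n --> oo, it contains the sign of x_ij - a;
  so the sets whose indicator is a multiplier form a sigma-algebra containing
  all half-spaces, hence all Borel sets.
*)

(** * Bounded measurable functions *)

(** This class is closed under the ring operations and integrable for every probability measure, so
    the rules for the real-valued integral below need no separate integrability hypotheses. *)
Definition bounded_measurable {d} {T : measurableType d} {R : realType}
    (f : T -> R) :=
  measurable_fun setT f /\ exists M, forall x, `|f x| <= M.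

Section BoundedMeasurable.
Context {d} {T : measurableType d} {R : realType}.
Implicit Types f g : T -> R.

Lemma bounded_measurable_cst (r : R) : bounded_measurable (fun _ : T => r).
Proof. by split; [exact: measurable_cst | exists `|r|]. Qed.

Lemma bounded_measurableD f g : bounded_measurable f -> bounded_measurable g ->
  bounded_measurable (fun x => f x + g x).
Proof.
move=> [mf [M fM]] [mg [N gN]]; split; first exact: measurable_funD.
by exists (M + N) => x; rewrite (le_trans (ler_normD _ _))// lerD.
Qed.

Lemma bounded_measurableM f g : bounded_measurable f -> bounded_measurable g ->
  bounded_measurable (fun x => f x * g x).
Proof.
move=> [mf [M fM]] [mg [N gN]]; split; first exact: measurable_funM.
by exists (M * N) => x; rewrite normrM ler_pM.
Qed.

Lemma bounded_measurableN f : bounded_measurable f ->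
  bounded_measurable (fun x => - f x).
Proof.
move=> [mf [M fM]]; split; first exact: measurable_funN.
by exists M => x; rewrite normrN.
Qed.

Lemma bounded_measurableB f g : bounded_measurable f -> bounded_measurable g ->
  bounded_measurable (fun x => f x - g x).
Proof. by move=> bf bg; apply/bounded_measurableD/bounded_measurableN. Qed.

Lemma bounded_measurable_sum I (s : seq I) (h : I -> T -> R) :
  (forall i, bounded_measurable (h i)) ->
  bounded_measurable (fun x => \sum_(i <- s) h i x).
Proof.
move=> bh; elim: s => [|i s IH].
  by under eq_fun do rewrite big_nil; exact: bounded_measurable_cst.
by under eq_fun do rewrite big_cons; exact: bounded_measurableD.
Qed.

Lemma bounded_measurable_indic (A : set T) : measurable A ->
  bounded_measurable (\1_A : T -> R).
Proof.
move=> mA; split; first exact: measurable_indic.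
by exists 1 => x; rewrite indicE; case: (_ \in _); rewrite ?normr1 ?normr0.
Qed.

Variable P : probability T R.

Lemma bounded_measurable_integrable f : bounded_measurable f ->
  P.-integrable setT (EFin \o f).
Proof.
move=> [mf [M fM]]; apply: measurable_bounded_integrable => //.
  by rewrite [ltLHS]probability_setT ltry.
by exists M; split; [exact: num_real | move=> y My x _; exact: le_trans (fM x) (ltW My)].
Qed.

Lemma Rintegral_probability_cst (r : R) : \int[P]_x r = r.
Proof.
rewrite Rintegral_cst//.
set y := fine _; have -> : y = 1 by rewrite /y [X in fine X]probability_setT.
by rewrite mulr1.
Qed.

Lemma Rintegral_bmD f g : bounded_measurable f -> bounded_measurable g ->
  \int[P]_x (f x + g x) = \int[P]_x f x + \int[P]_x g x.
Proof.
by move=> bf bg; rewrite RintegralD//; exact: bounded_measurable_integrable.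
Qed.

Lemma Rintegral_bmB f g : bounded_measurable f -> bounded_measurable g ->
  \int[P]_x (f x - g x) = \int[P]_x f x - \int[P]_x g x.
Proof.
by move=> bf bg; rewrite RintegralB//; exact: bounded_measurable_integrable.
Qed.

Lemma Rintegral_bmZ r f : bounded_measurable f ->
  \int[P]_x (r * f x) = r * \int[P]_x f x.
Proof.
by move=> bf; rewrite RintegralZl//; exact: bounded_measurable_integrable.
Qed.

Lemma le_Rintegral_bm f g : bounded_measurable f -> bounded_measurable g ->
  (forall x, f x <= g x) -> \int[P]_x f x <= \int[P]_x g x.
Proof.
move=> bf bg fg; apply: le_Rintegral => //.
- exact: bounded_measurable_integrable.
- exact: bounded_measurable_integrable.
Qed.

Lemma Rintegral_bm_sum I (s : seq I) (h : I -> T -> R) :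
  (forall i, bounded_measurable (h i)) ->
  \int[P]_x (\sum_(i <- s) h i x) = \sum_(i <- s) \int[P]_x h i x.
Proof.
move=> bh; elim: s => [|i s IH].
  rewrite big_nil -[RHS]Rintegral_probability_cst.
  by apply: eq_Rintegral => x _; rewrite big_nil.
rewrite big_cons -IH -Rintegral_bmD//; last exact: bounded_measurable_sum.
by apply: eq_Rintegral => x _; rewrite big_cons.
Qed.

Lemma Rintegral_indic_probability (A : set T) : measurable A ->
  \int[P]_x \1_A x = fine (P A).
Proof. by move=> mA; rewrite /Rintegral integral_indic// setIT. Qed.

Lemma EFin_Rintegral_bm f : bounded_measurable f ->
  (\int[P]_x f x)%:E = (\int[P]_x (f x)%:E)%E.
Proof.
move=> bf; rewrite /Rintegral fineK//.
by apply: integrable_fin_num => //; exact: bounded_measurable_integrable.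
Qed.

(** Dominated convergence with a constant as dominating function; the pointwise limit inherits
    measurability and the bound. *)
Lemma bounded_cvg_Rintegral (h : nat -> T -> R) f (M : R) :
  (forall n, measurable_fun setT (h n)) -> (forall n x, `|h n x| <= M) ->
  (forall x, h n x @[n --> \oo] --> f x) ->
  bounded_measurable f /\
  \int[P]_x h n x @[n --> \oo] --> \int[P]_x f x.
Proof.
move=> mh hM hf.
have bh n : bounded_measurable (h n) by split; [|exists M; exact: hM].
have bf : bounded_measurable f.
  split; first by apply: (measurable_fun_cvg mh) => x _; exact: hf.
  exists M => x; rewrite -(cvg_lim _ (cvg_norm (hf x)))//.
  apply: limr_le; first exact: (cvgP _ (cvg_norm (hf x))).
  by apply: nearW => n; exact: hM.
split=> //; apply: fine_cvg; rewrite EFin_Rintegral_bm//.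
apply: (@dominated_cvg _ _ _ P setT measurableT (fun n x => (h n x)%:E)
  (fun x => (f x)%:E) (fun _ => M%:E)) => //.
- by move=> n; apply/measurable_EFinP; exact: mh.
- by move=> x _; apply: cvg_EFin; [exact: nearW | exact: hf].
- exact: (@bounded_measurable_integrable (fun=> M) (bounded_measurable_cst M)).
- by move=> n x _; rewrite lee_fin hM.
Qed.
End BoundedMeasurable.

(** * Strong law of large numbers for events *)

Lemma between_squares n : (0 < n)%N ->
  exists k, (k.+1 ^ 2 <= n < k.+2 ^ 2)%N.
Proof.
case: n => // n _; elim: n => [|n [k /andP[kn nk]]]; first by exists 0%N.
have [lt|ge] := ltnP n.+2 (k.+2 ^ 2)%N.
  by exists k; rewrite lt andbT (leq_trans kn).
exists k.+1; rewrite ge /=; move: nk; rewrite !expnS !expn0; nia.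
Qed.

(** From [(k+1)^2] to any [n < (k+2)^2] the sequence moves by at most [2 (k+1)], which is negligible
    against [(k+1)^2 <= n]. *)
Lemma cvg_along_squares (R : realType) (s : nat -> R) :
  (forall m n, (m <= n)%N -> `|s n - s m| <= (n - m)%:R) ->
  (k.+1 ^ 2)%:R^-1 * s (k.+1 ^ 2)%N @[k --> \oo] --> 0 ->
  n%:R^-1 * s n @[n --> \oo] --> 0.
Proof.
move=> ls /cvgr0Pnorm_lt cs; apply/cvgr0Pnorm_lt => e e0.
have e20 : 0 < e / 2 by lra.
have e40 : 0 < e / 4 by lra.
have [K1 _ HK1] := cs _ e20.
(* Beyond [4 / e], an increment of [2 (k+1)] divided by [(k+1)^2] is less than [e / 2]; the other
   half of [e] comes from the convergence along squares. *)
have [K2 HK2] : exists K2 : nat, 4 / e < K2%:R.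
  by exists (Num.truncn (4 / e)).+1; exact: truncnS_gt.
exists ((K1 + K2).+1 ^ 2)%N => // n /= nK.
have n0 : (0 < n)%N by rewrite (leq_trans _ nK)// expn_gt0.
have [k /andP[kn nk]] := between_squares n0.
have kK : (K1 + K2 < k.+1)%N by rewrite !expnS !expn0 in nk nK; nia.
have /HK1 /= : (K1 <= k)%N by lia.
have := ls _ _ kn.
set b := s n; set a := s _; set m := (k.+1 ^ 2)%N in kn *.
have normV (t : nat) (y : R) : `|t%:R^-1 * y| = t%:R^-1 * `|y|.
  by rewrite normrM [X in X * _]ger0_norm// invr_ge0.
rewrite !normV => ba am.
have m0 : 0 < m%:R :> R by rewrite ltr0n expn_gt0.
have n0' : 0 < n%:R :> R by rewrite ltr0n.
have mn : m%:R <= n%:R :> R by rewrite ler_nat.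
have nm : (n - m)%:R <= 2 * k.+1%:R :> R.
  by rewrite -natrM ler_nat /m; rewrite !expnS !expn0 in nk kn *; nia.
have mk : m%:R = k.+1%:R * k.+1%:R :> R by rewrite -natrM /m expnS expn1.
have k4 : 4 < e * k.+1%:R.
  rewrite mulrC -ltr_pdivrMr// (lt_trans HK2)// ltr_nat; lia.
rewrite mulrC ltr_pdivrMr//.
rewrite mulrC ltr_pdivrMr// in am.
have : `|b| <= `|a| + 2 * k.+1%:R.
  by rewrite -[b](subrK a) addrC (le_trans (ler_normD _ _))// lerD2l (le_trans ba).
have k0 : 0 < k.+1%:R :> R by rewrite ltr0n.
nra.
Qed.

Section StrongLawEvents.
Context {d} {T : measurableType d} {R : realType} {P : probability T R}.
Variables (A : nat -> set T) (q : R).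
Hypothesis mA : forall j, measurable (A j).
Hypothesis PA : forall j, P (A j) = q%:E.
Hypothesis PAA : forall i j, i != j -> P (A i `&` A j) = (q * q)%:E.

Let Y j x : R := \1_(A j) x - q.
Let S n x := \sum_(j < n) Y j x.

Let q01 : 0 <= q <= 1.
Proof.
rewrite -!lee_fin -(PA 0) measure_ge0 /=.
exact: probability_le1.
Qed.

Let bY j : bounded_measurable (Y j).
Proof.
by apply: bounded_measurableB; [exact: bounded_measurable_indic|exact: bounded_measurable_cst].
Qed.

Let bS n : bounded_measurable (S n).
Proof. exact: bounded_measurable_sum. Qed.

Let Y_le1 j x : `|Y j x| <= 1.
Proof. by move: q01; rewrite /Y indicE ler_norml; case: (_ \in _) => /=; lra. Qed.

(** The covariances: pairwise independence makes the centred indicators orthogonal. *)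
Let EY i j : \int[P]_x (Y i x * Y j x) = if i == j then q - q * q else 0.
Proof.
have bI k : bounded_measurable (\1_(A k) : T -> R) by exact: bounded_measurable_indic.
have EI k : \int[P]_x \1_(A k) x = q by rewrite Rintegral_indic_probability// PA.
transitivity (\int[P]_x (\1_(A i `&` A j) x - (q * \1_(A i) x + (q * \1_(A j) x - q * q)))).
  by apply: eq_Rintegral => x _; rewrite /Y indicI /=; ring.
have bc r k : bounded_measurable (fun x => r * \1_(A k) x : R).
  by apply: bounded_measurableM => //; exact: bounded_measurable_cst.
have bB : bounded_measurable (fun x => q * \1_(A j) x - q * q).
  by apply: bounded_measurableB => //; exact: bounded_measurable_cst.
rewrite Rintegral_bmB; last 2 first.
  by apply: bounded_measurable_indic; exact: measurableI.
  exact: bounded_measurableD.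
rewrite Rintegral_bmD// Rintegral_bmB//; last exact: bounded_measurable_cst.
rewrite Rintegral_probability_cst !Rintegral_bmZ// !EI.
rewrite Rintegral_indic_probability; last exact: measurableI.
case: eqVneq => [->|ij]; first by rewrite setIid PA /=; ring.
by rewrite PAA//=; ring.
Qed.

Let ES2 n : \int[P]_x (S n x ^+ 2) <= n%:R.
Proof.
have -> : \int[P]_x (S n x ^+ 2) = \sum_(i < n) \sum_(j < n) \int[P]_x (Y i x * Y j x).
  transitivity (\int[P]_x (\sum_(i < n) \sum_(j < n) Y i x * Y j x)).
    by apply: eq_Rintegral => x _; rewrite expr2 /S big_distrlr.
  have bb (i j : 'I_n) : bounded_measurable (fun x => Y i x * Y j x).
    exact: bounded_measurableM.
  rewrite Rintegral_bm_sum; last by move=> i; exact: bounded_measurable_sum.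
  by apply: eq_bigr => i _; rewrite Rintegral_bm_sum.
have -> : n%:R = \sum_(i < n) (1 : R) by rewrite sumr_const card_ord.
apply: ler_sum => i _; rewrite (bigD1 i)//= EY eqxx big1 ?addr0.
  by move: q01; nra.
by move=> j ji; rewrite EY eq_sym val_eqE (negbTE ji).
Qed.

Let Z k x : R := ((k.+1 ^ 2)%:R^-1 * S (k.+1 ^ 2)%N x) ^+ 2.

Let bZ k : bounded_measurable (Z k).
Proof.
have bb : bounded_measurable (fun x => (k.+1 ^ 2)%:R^-1 * S (k.+1 ^ 2)%N x : R).
  by apply: bounded_measurableM => //; exact: bounded_measurable_cst.
exact: (bounded_measurableM bb bb).
Qed.

(** The variance bound gives [1 / (k+1)^2], which is at most [2 / ((k+1) (k+2))]; in this form the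
    sum over [k] telescopes. *)
Let EZ k : \int[P]_x Z k x <= 2 * (k.+1%:R^-1 - k.+2%:R^-1).
Proof.
have -> : \int[P]_x Z k x = (k.+1 ^ 2)%:R^-1 ^+ 2 * \int[P]_x (S (k.+1 ^ 2)%N x ^+ 2).
  rewrite -Rintegral_bmZ; last exact: (bounded_measurableM (bS _) (bS _)).
  by apply: eq_Rintegral => x _; rewrite /Z exprMn.
have k0 : 0 < k.+1%:R :> R by rewrite ltr0n.
have kk0 : 0 < k.+2%:R :> R by rewrite ltr0n.
apply: (@le_trans _ _ ((k.+1 ^ 2)%:R^-1 ^+ 2 * (k.+1 ^ 2)%:R)).
  by rewrite ler_wpM2l// exprn_ge0.
rewrite natrX.
have -> : k.+1%:R^-1 - k.+2%:R^-1 = k.+1%:R^-1 * k.+2%:R^-1 :> R.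
  by rewrite -[k.+2]addn1 natrD; field; apply/andP; split; lra.
have -> : (k.+1%:R ^+ 2)^-1 ^+ 2 * (k.+1%:R ^+ 2) = k.+1%:R^-1 * k.+1%:R^-1 :> R.
  by field; lra.
rewrite mulrCA ler_pM2l ?invr_gt0// -[leLHS]mul1r ler_pdivrMr// mulrAC ler_pdivlMr//.
rewrite -[k.+2]addn1 natrD.
have : 1 <= k.+1%:R :> R by rewrite ler1n.
lra.
Qed.

Let sumEZ : (\sum_(k <oo) \int[P]_x (Z k x)%:E <= 2%:E)%E.
Proof.
have Z0 k x : 0 <= Z k x by exact: sqr_ge0.
apply: lime_le.
  by apply: is_cvg_nneseries => k _ _; apply: integral_ge0 => x _; rewrite lee_fin.
apply: nearW => n /=.
under eq_bigr do rewrite -EFin_Rintegral_bm//.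
rewrite sumEFin lee_fin.
apply: (@le_trans _ _ (\sum_(0 <= k < n) 2 * (k.+1%:R^-1 - k.+2%:R^-1))).
  exact: ler_sum.
rewrite -mulr_sumr -[leRHS]mulr1 ler_pM2l//.
have -> : \sum_(0 <= k < n) (k.+1%:R^-1 - k.+2%:R^-1) = 1 - n.+1%:R^-1 :> R.
  elim: n => [|n IH]; first by rewrite big_nil invr1 subrr.
  by rewrite big_nat_recr//= IH; ring.
by rewrite gerBl.
Qed.

(** The squared mean deviations [Z k] have a finite expected sum, so almost surely they are summable
    and tend to [0]; this is convergence along the squares, and the gaps are filled because each
    term of [S] is at most [1] in absolute value. *)
Lemma strong_law_events :
  {ae P, forall x, n%:R^-1 * \sum_(j < n) \1_(A j) x @[n --> \oo] --> q}.
Proof.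
have Z0 k x : 0 <= Z k x by exact: sqr_ge0.
have mZ k : measurable_fun setT (EFin \o Z k).
  by apply/measurable_EFinP; have [] := bZ k.
have mfin : measurable_fun setT (fun x => \sum_(k <oo) (Z k x)%:E)%E.
  apply: (@ge0_emeasurable_sum _ _ _ _ (fun k => EFin \o Z k) xpredT) => // k x _ _.
  by rewrite /= lee_fin.
have : P.-integrable setT (fun x => \sum_(k <oo) (Z k x)%:E)%E.
  apply/integrableP; split=> //.
  rewrite (eq_integral (fun x => \sum_(k <oo) (Z k x)%:E)%E); last first.
    by move=> x _; rewrite gee0_abs// nneseries_ge0// => k _ _; rewrite lee_fin.
  rewrite integral_nneseries//; last by move=> k x _; rewrite lee_fin.
  by rewrite (le_lt_trans sumEZ)// ltry.
move=> /(integrable_ae measurableT); apply: filterS => x /(_ I) Zfin.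
have cS : n%:R^-1 * S n x @[n --> \oo] --> 0.
  apply: (@cvg_along_squares _ (S ^~ x)) => [m n mn|].
    rewrite /S -!(big_mkord xpredT (fun j => Y j x)) (big_cat_nat _ mn)//= addrAC subrr add0r.
    rewrite (le_trans (ler_norm_sum _ _ _))//.
    rewrite (le_trans (ler_sum _ (fun j _ => Y_le1 j x)))//.
    by rewrite sumr_const_nat.
  have cZ : Z k x @[k --> \oo] --> 0.
    apply: cvg_series_cvg_0.
    apply: nondecreasing_is_cvgn; first by apply: nondecreasing_series => k _ _; exact: Z0.
    exists (fine (\sum_(k <oo) (Z k x)%:E)%E) => _ [m _ <-].
    rewrite -lee_fin fineK// /series /= -sumEFin.
    by apply: nneseries_lim_ge => k _ _; rewrite lee_fin.
  apply/cvgr0Pnorm_lt => e e0; have e20 : 0 < e ^+ 2 by exact: exprn_gt0.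
  move/cvgr0Pnorm_lt : cZ => /(_ _ e20); apply: filterS => k.
  by rewrite /Z normrX ltr_pXn2r// nnegrE ltW.
rewrite -[q]add0r; apply: (cvg_trans _ (cvgD cS (cvg_cst q))).
(* The two sequences agree for [n > 0] only: at [n = 0] the inverse is [0] by convention and the
   mean is lost. *)
apply: near_eq_cvg; near=> n.
have n0 : (0 < n)%N by near: n; exact: nbhs_infty_gt.
transitivity (n%:R^-1 * S n x + q); first by [].
rewrite /S /Y sumrB sumr_const card_ord mulrBr -[q *+ n]mulr_natl mulKf ?subrK//.
by rewrite pnatr_eq0 -lt0n.
Unshelve. all: by end_near. Qed.
End StrongLawEvents.

(** * Borel and Lebesgue measurability on matrices *)

Section MatrixMeasurability.
Context {R : realType} {d p : nat}.
Local Notation M := 'M[R]_(d, p).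

Lemma rational_mx_near (x : M) (e : R) : 0 < e ->
  exists q : 'M[rat]_(d, p), forall i j, `|ratr (q i j) - x i j| < e.
Proof.
move=> e0.
have near_rat (r : R) : exists s : rat, `|ratr s - r| < e.
  have /rat_in_itvoo[s] : r - e < r + e by lra.
  by rewrite in_itv /= => /andP[rs sr]; exists s; rewrite ltr_norml; lra.
have /choice[f xf] : forall ij : 'I_d * 'I_p, exists s : rat, `|ratr s - x ij.1 ij.2| < e.
  by move=> ij; exact: near_rat.
by exists (\matrix_(i, j) f (i, j)) => i j; rewrite mxE (xf (i, j)).
Qed.

(** An open set is the union of the countably many boxes with rational centre and radius [1 / (n+1)]
    that it contains, so measurable coordinates suffice. The sigma-algebra on the source is left
    free: Borel, Lebesgue, or the one formed by multipliers. *)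
Lemma measurable_preimage_open (dT : measure_display) (T : measurableType dT)
    (f : T -> M) :
  (forall i j, measurable_fun setT (fun t => f t i j)) ->
  forall U : set M, open U -> measurable (f @^-1` U).
Proof.
move=> mf U oU.
pose I := ('M[rat]_(d, p) * nat)%type.
pose box (k : I) : set M :=
  [set x | forall i j, `|ratr (k.1 i j) - x i j| < k.2.+1%:R^-1].
pose F (k : I) : set T := if pselect (box k `<=` U) then f @^-1` box k else set0.
have -> : f @^-1` U = \bigcup_k F k.
  apply/seteqP; split=> [t /= Uft|t [k _]]; last by rewrite /F; case: pselect => // + /=; apply.
  have [e e0 eU] : exists2 e : R, 0 < e & ball (f t) e `<=` U.
    by apply/nbhs_ballP; move: oU; rewrite openE; exact.
  (* Half of [e] is for the distance from [f t] to the rational centre, half for the radius of the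
     box. *)
  have [n ne] : exists n, n.+1%:R^-1 < e / 2.
    have e20 : 0 < e / 2 by lra.
    by have [n _ /(_ n (leqnn n))] := near_infty_natSinv_lt (PosNum e20); exists n.
  have n0 : 0 < n.+1%:R^-1 :> R by rewrite invr_gt0.
  have ne2 : n.+1%:R^-1 + n.+1%:R^-1 < e by move: ne; set r := _^-1 => ne; lra.
  have [q xq] := rational_mx_near (f t) n0.
  exists (q, n) => //; rewrite /F; case: pselect => [//|]; apply.
  move=> y /= yq; apply: eU; split => // i j; rewrite /ball /=.
  have -> : f t i j - y i j = (ratr (q i j) - y i j) - (ratr (q i j) - f t i j) by ring.
  rewrite (le_lt_trans (ler_normB _ _))//.
  exact: (lt_trans (ltrD (yq i j) (xq i j)) ne2).
apply: (@countable_bigcupT_measurable _ _ I F) => [|k]; first exact: countableP.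
rewrite /F; case: pselect => [? /=|? /=]; last exact: measurable0.
have -> : f @^-1` box k = \bigcap_(ij in [set: 'I_d * 'I_p])
    [set t | `|ratr (k.1 ij.1 ij.2) - f t ij.1 ij.2| < k.2.+1%:R^-1].
  by apply/seteqP; split=> t /= => [kt [i j] _|kt i j]; [exact: kt|exact: (kt (i, j))].
apply: fin_bigcap_measurable => [|[i j] _ /=]; first exact: finite_finset.
have H := mf i j measurableT _ (measurable_ball (ratr (k.1 i j) : R) k.2.+1%:R^-1).
by rewrite setTI in H; exact H.
Qed.

Lemma measurable_fun_continuous (dT : measure_display) (T : measurableType dT)
    (f : T -> M) (g : M -> R) :
  (forall i j, measurable_fun setT (fun t => f t i j)) -> continuous g ->
  measurable_fun setT (g \o f).
Proof.
move=> mf /continuousP cg; apply: (measurability _ (RGenOpens.measurableE R)).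
move=> _ [_ [a [b ->] <-]]; rewrite setTI.
rewrite comp_preimage; apply: (measurable_preimage_open mf).
exact/cg/interval_open.
Qed.

Lemma measurable_borel_coord i j :
  measurable_fun setT (fun x : borel_mx R d p => (x : M) i j).
Proof.
apply: (measurability _ (RGenOpens.measurableE R)).
move=> _ [_ [a [b ->] <-]]; rewrite setTI; apply: sub_sigma_algebra => /=.
by move/continuousP : (@coord_continuous R d p i j); apply; exact: interval_open.
Qed.

Lemma measurable_borel_continuous (g : M -> R) : continuous g ->
  measurable_fun setT (g : borel_mx R d p -> R).
Proof.
move=> cg.
exact: (measurable_fun_continuous (f := fun x : borel_mx R d p => x) measurable_borel_coord).
Qed.

Definition upd_mx (a : M) i j v : M :=
  \matrix_(k, l) if (k, l) == (i, j) then v else a k l.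

Lemma box_volumeE (a b : M) i j :
  box_volume a b = Num.max 0 (b i j - a i j) *
    \prod_(kl | kl != (i, j)) Num.max 0 (b kl.1 kl.2 - a kl.1 kl.2).
Proof. by rewrite /box_volume pair_bigA /= (bigD1 (i, j)). Qed.

(** Cutting a box by the hyperplane [x i j = c] changes a single factor of the volume; the
    truncation of edge lengths at [0] also covers cuts that miss the box. *)
Lemma box_volume_split (a b : M) i j c :
  box_volume (upd_mx a i j (Num.max (a i j) c)) b +
  box_volume a (upd_mx b i j (Num.min (b i j) c)) = box_volume a b.
Proof.
rewrite !(box_volumeE _ _ i j) !mxE eqxx.
under eq_bigr => kl kl_ij do rewrite mxE -surjective_pairing (negbTE kl_ij).
under [X in _ + _ * X]eq_bigr => kl kl_ij do rewrite mxE -surjective_pairing (negbTE kl_ij).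
rewrite -mulrDl; congr (_ * _).
rewrite /Num.max /Num.min; repeat case: ifPn; rewrite -?leNgt; lra.
Qed.

(** Any cover of [A] by boxes is cut into covers of the two parts of [A] with the same total volume.
    Boxes are open below and closed above, so the pieces match [c < x i j] and its complement
    exactly. *)
Lemma caratheodory_halfspace i j (c : R) :
  (@lebesgue_outer R d p).-caratheodory [set x : M | c < x i j].
Proof.
apply: le_caratheodory_measurable => A /=.
apply: le_ereal_inf_tmp => _ [[D B] /= cA <-].
pose B1 k := (upd_mx (B k).1 i j (Num.max ((B k).1 i j) c), (B k).2).
pose B2 k := ((B k).1, upd_mx (B k).2 i j (Num.min ((B k).2 i j) c)).
apply: (@le_trans _ _ (\sum_(k <oo | k \in D) (box_volume (B1 k).1 (B1 k).2)%:E +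
  \sum_(k <oo | k \in D) (box_volume (B2 k).1 (B2 k).2)%:E)%E); last first.
  rewrite -nneseriesD; last 2 first.
    by move=> k _ _; rewrite lee_fin box_volume_ge0.
    by move=> k _ _; rewrite lee_fin box_volume_ge0.
  under eq_eseriesr do rewrite -EFinD box_volume_split.
  exact: lexx.
apply: leeD; apply: ereal_inf_lbound.
- exists (D, B1) => // x [Ax cx]; have [k Dk Bx] := cA _ Ax.
  exists k => // k1 l1; rewrite /= mxE; have := Bx k1 l1.
  by case: eqP => [[-> ->]|//]; rewrite gt_max => /andP[-> ->]; rewrite cx.
- exists (D, B2) => // x [Ax cx]; have [k Dk Bx] := cA _ Ax.
  exists k => // k1 l1; rewrite /= mxE; have := Bx k1 l1.
  by case: eqP => [[-> ->]|//]; rewrite le_min => /andP[-> ->]; rewrite leNgt; exact/negP.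
Qed.

Lemma measurable_lebesgue_coord i j :
  measurable_fun setT (fun x : lebesgue_mx R d p => (x : M) i j).
Proof.
apply: (measurability _ (RGenOInfty.measurableE R)).
move=> _ [_ [c ->] <-]; rewrite setTI preimage_itvoy.
exact: (caratheodory_halfspace i j c).
Qed.

Lemma measurable_lebesgue_continuous (g : M -> R) : continuous g ->
  measurable_fun setT (g : lebesgue_mx R d p -> R).
Proof.
move=> cg.
exact: (measurable_fun_continuous (f := fun x : lebesgue_mx R d p => x) measurable_lebesgue_coord).
Qed.

Lemma lebesgue_outer_translate (A : set M) (v : M) :
  (lebesgue_outer [set x | A (x - v)%R] <= lebesgue_outer A)%E.
Proof.
apply: le_ereal_inf_tmp => _ [[D B] /= cA <-]; apply: ereal_inf_lbound.
exists (D, fun k => ((B k).1 + v, (B k).2 + v)) => /=.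
  move=> x /= /cA[k Dk Bx]; exists k => // i j.
  by move: (Bx i j); rewrite /= !mxE; lra.
apply: eq_eseriesr => k _; congr EFin; apply: eq_bigr => i _; apply: eq_bigr => j _.
by rewrite !mxE; congr Num.max; ring.
Qed.

Lemma lebesgue_outer_open_null (U : set M) : open U -> U !=set0 ->
  lebesgue_outer U = 0%E -> lebesgue_outer [set: M] = 0%E.
Proof.
move=> oU [x Ux] U0; apply/eqP; rewrite eq_le lebesgue_outer_ge0 andbT.
pose rm (q : 'M[rat]_(d, p)) : M := map_mx ratr q.
(* The rational translates of [U], enumerated through their codes; a number that codes no matrix
   gives the empty set. *)
pose F n : set M :=
  if @choice.unpickle 'M[rat]_(d, p) n is Some q then [set y | U (y - rm q)] else set0.
have -> : [set: M] = \bigcup_n F n.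
  apply/seteqP; split=> // y _.
  have [e e0 eU] : exists2 e : R, 0 < e & ball x e `<=` U.
    by apply/nbhs_ballP; move: oU; rewrite openE; exact.
  (* If [q] is close to [y - x], then [y - q] is close to [x] and hence in [U]. *)
  have [q yq] := rational_mx_near (y - x) e0.
  exists (choice.pickle q) => //; rewrite /F choice.pickleK /=; apply: eU; split=> // i j.
  rewrite /ball /= !mxE; have := yq i j; rewrite !mxE.
  by congr (`|_| < _); ring.
apply: (le_trans (outer_measure_sigma_subadditive _ F)).
rewrite eseries0// => n _ _; apply/eqP; rewrite eq_le outer_measure_ge0 andbT /F.
case: choice.unpickle => [q|]; last by rewrite outer_measure0.
by rewrite -U0; exact: lebesgue_outer_translate.
Qed.

End MatrixMeasurability.

(** * Uniqueness of characteristic functions *)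

Section SignApproximation.
Context {R : realType}.

(** The Newton-Schulz step for the sign function: an odd polynomial with fixed points [-1], [0] and
    [1], the outer two attracting. *)
Definition sign_step (u : R) : R := (3 * u - u ^+ 3) / 2.

Lemma sign_stepN u : sign_step (- u) = - sign_step u.
Proof. by rewrite /sign_step; field. Qed.

Lemma norm_iter_sign_step n (u : R) : `|u| <= 1 -> `|iter n sign_step u| <= 1.
Proof.
move=> u1; elim: n => //= n; move: (iter n _ u) => {u1}u.
rewrite !ler_norml /sign_step => /andP[u1 u2].
(* This product is [2 (1 + sign_step u)], and the next one is [2 (1 - sign_step u)]. *)
have : 0 <= (1 + u) ^+ 2 * (2 - u) by rewrite mulr_ge0 ?sqr_ge0//; lra.
have : 0 <= (1 - u) ^+ 2 * (2 + u) by rewrite mulr_ge0 ?sqr_ge0//; lra.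
lra.
Qed.

Lemma cvg_iter_sign_step (u : R) : `|u| <= 1 ->
  iter n sign_step u @[n --> \oo] --> Num.sg u.
Proof.
have pos (v : R) : 0 < v <= 1 -> iter n sign_step v @[n --> \oo] --> (1 : R).
  (* A step from [w] multiplies the distance to [1] by [1 - (w + w^2) / 2], which is at most [z]
     when [w >= v]; the iterates never drop below [v], so [z] is a uniform contraction rate. *)
  move=> /andP[v0 v1]; pose z := 1 - v / 2.
  have z0 : 0 <= z < 1 by rewrite /z; lra.
  have vn n : v <= iter n sign_step v <= 1 /\ 1 - iter n sign_step v <= z ^+ n.
    elim: n => [|n [/= /andP[]]]; first by rewrite /= expr0; lra.
    move: (iter n _ v) => w vw w1 wz.
    have -> : sign_step w = 1 - (1 - w) * (1 - (w + w ^+ 2) / 2).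
      by rewrite /sign_step; field.
    have : (1 - w) * (1 - (w + w ^+ 2) / 2) <= (1 - w) * z.
      by rewrite ler_wpM2l ?subr_ge0// /z; nra.
    have : (1 - w) * z <= z ^+ n * z by rewrite ler_wpM2r//; lra.
    have : 0 <= (1 - w) * (1 - (w + w ^+ 2) / 2) <= 1 - w.
      by apply/andP; split; [apply: mulr_ge0; nra|rewrite -[leRHS]mulr1 ler_wpM2l; nra].
    rewrite (exprSr z n).
    move: (_ * (1 - _)) (_ * z) (_ * z) => a b c; lra.
  have zn : z ^+ n @[n --> \oo] --> 0.
    by apply: cvg_expr; rewrite ger0_norm; lra.
  apply: (squeeze_cvgr (f := fun n => 1 - z ^+ n) (h := fun=> 1)).
  - by apply: nearW => n /=; have [/andP[_ ->]] := vn n; rewrite andbT; lra.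
  - by rewrite -[X in _ --> X]subr0; apply: cvgB => //; exact: cvg_cst.
  - exact: cvg_cst.
move=> u1; have [u0|u0|->] := ltrgt0P u.
- by rewrite gtr0_sg//; apply: pos; rewrite u0 (le_trans (ler_norm u)).
- rewrite ltr0_sg//.
  have -> : (fun n => iter n sign_step u) = (fun n => - iter n sign_step (- u)).
    apply/funext => n; rewrite -{1}[u]opprK.
    by elim: n (- u) => //= n IH v; rewrite IH sign_stepN.
  by apply: cvgN; apply: pos; rewrite oppr_gt0 u0 (le_trans (ler_norm _))// normrN.
- rewrite sgr0; have -> : (fun n => iter n sign_step 0) = (fun=> 0).
    by apply/funext; elim=> //= n ->; rewrite /sign_step; field.
  exact: cvg_cst.
Qed.

(** Once [n + 1] exceeds the absolute value of [y], the scaled argument lies strictly between [-pi]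
    and [pi], where the sine has the sign of its argument. *)
Lemma sg_sin_scaled (y : R) :
  \forall n \near \oo, Num.sg (sin (n.+1%:R^-1 * y)) = Num.sg y.
Proof.
have pos (v : R) : 0 < v -> \forall n \near \oo, 0 < sin (n.+1%:R^-1 * v).
  move=> v0; exists (Num.truncn v) => // n /= vn.
  have n0 : 0 < n.+1%:R :> R by rewrite ltr0n.
  apply: sin_gt0_pi; rewrite mulr_gt0 ?invr_gt0//= mulrC ltr_pdivrMr//.
  rewrite (lt_le_trans (truncnS_gt v))// (@le_trans _ _ n.+1%:R) ?ler_nat//.
  rewrite ler_peMl ?ltW//; have := @pi_ge2 R; lra.
have [y0|y0|->] := ltrgt0P y.
- by move: (pos _ y0); apply: filterS => n s0; rewrite !gtr0_sg.
- have /pos : 0 < - y by rewrite oppr_gt0.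
  by apply: filterS => n; rewrite mulrN sinN oppr_gt0 => s0; rewrite !ltr0_sg.
- by apply: nearW => n; rewrite mulr0 sin0 !sgr0.
Qed.

Lemma cos_lipschitz (a b : R) : `|cos a - cos b| <= `|a - b|.
Proof.
wlog ab : a b / b <= a.
  move=> H; have [/H//|ab] := leP b a.
  by rewrite distrC (distrC a); apply: H; exact: ltW.
have der x : x \in `]b, a[%R -> is_derive x 1 (@cos R) (- sin x).
  by move=> _; exact: is_derive_cos.
have cc : {within `[b, a], continuous (@cos R)}.
  by apply: continuous_subspaceT => x; exact: continuous_cos.
have [c _ ->] := MVT_segment ab der cc.
by rewrite normrM normrN ler_piMl// sin_max.
Qed.

Lemma sin_lipschitz (a b : R) : `|sin a - sin b| <= `|a - b|.
Proof.
rewrite -!cosBpihalf (le_trans (cos_lipschitz _ _))// opprB addrA subrK.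
exact: lexx.
Qed.
End SignApproximation.

Lemma cvg_bigsum {R : realType} {T : Type} {F : set_system T} {FF : Filter F}
    I (s : seq I) (f : I -> T -> R) (l : I -> R) :
  (forall i, f i x @[x --> F] --> l i) ->
  \sum_(i <- s) f i x @[x --> F] --> \sum_(i <- s) l i.
Proof.
move=> fl; elim: s => [|i s IH].
  by rewrite big_nil; under eq_cvg do rewrite big_nil; exact: cvg_cst.
by rewrite big_cons; under eq_cvg do rewrite big_cons; exact: cvgD.
Qed.

(** * The trace inner product *)

Section MatrixDot.
Context {R : realType} {d p : nat}.
Implicit Types t x : 'M[R]_(d, p).

(** The Frobenius inner product, which is the phase in the characteristic function. *)
Definition mxdot t x : R := \tr (t^T *m x).

Lemma mxdotE t x : mxdot t x = \sum_ij t ij.1 ij.2 * x ij.1 ij.2.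
Proof.
rewrite /mxdot /mxtrace; under eq_bigr do rewrite mxE.
rewrite exchange_big pair_bigA; apply: eq_bigr => -[i j] _ /=.
by rewrite mxE.
Qed.

Lemma mxdotDl t s x : mxdot (t + s) x = mxdot t x + mxdot s x.
Proof. by rewrite /mxdot raddfD mulmxDl raddfD. Qed.

Lemma mxdotNl t x : mxdot (- t) x = - mxdot t x.
Proof. by rewrite /mxdot raddfN mulNmx raddfN. Qed.

Lemma mxdotC t x : mxdot t x = mxdot x t.
Proof. by rewrite !mxdotE; apply: eq_bigr => ij _; rewrite mulrC. Qed.

Lemma mxdot0l x : mxdot 0 x = 0.
Proof. by rewrite /mxdot trmx0 mul0mx raddf0. Qed.

Lemma mxdot_delta c i j x : mxdot (c *: delta_mx i j) x = c * x i j.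
Proof.
rewrite mxdotE (bigD1 (i, j))//= !mxE !eqxx mulr1 big1 ?addr0// => -[k l].
rewrite -pair_eqE /= !mxE => kl.
by case: (k == i) (l == j) kl => -[]//= _; rewrite mulr0 mul0r.
Qed.

Lemma continuous_mxdotr t : continuous (mxdot t).
Proof.
have -> : mxdot t = fun y => \sum_ij t ij.1 ij.2 * y ij.1 ij.2.
  by apply/funext => y; exact: mxdotE.
move=> x; apply: (@cvg_bigsum R _ (nbhs x)) => ij.
by apply: cvgM; [exact: cvg_cst|exact: coord_continuous].
Qed.
End MatrixDot.

Lemma continuous_mxdotl {R : realType} {d p : nat} (x : 'M[R]_(d, p)) :
  continuous (mxdot^~ x).
Proof.
have -> : mxdot^~ x = mxdot x by apply/funext => t; exact: mxdotC.
exact: continuous_mxdotr.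
Qed.

(** * The algebra of multipliers *)

Section CharacteristicFunctionUniqueness.
Context {R : realType} {d p : nat}.
Local Notation M := 'M[R]_(d, p).
Local Notation T := (borel_mx R d p).

Lemma bounded_measurable_cos_mxdot (t : M) :
  bounded_measurable (fun x : T => cos (mxdot t x)).
Proof.
split; last by exists 1 => x; exact: cos_max.
apply: (@measurable_borel_continuous R d p (fun x => cos (mxdot t x))) => x.
by apply: continuous_comp; [exact: continuous_mxdotr|exact: continuous_cos].
Qed.

Lemma bounded_measurable_sin_mxdot (t : M) :
  bounded_measurable (fun x : T => sin (mxdot t x)).
Proof.
split; last by exists 1 => x; exact: sin_max.
apply: (@measurable_borel_continuous R d p (fun x => sin (mxdot t x))) => x.
by apply: continuous_comp; [exact: continuous_mxdotr|exact: continuous_sin].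
Qed.

Variables P Q : probability T R.

Definition same_integral (g : T -> R) := \int[P]_x g x = \int[Q]_x g x.

(** The signed measures with density [g] with respect to [P] and [Q] have the same characteristic
    function, expressed by its real and imaginary parts. *)
Definition same_transform (g : T -> R) := bounded_measurable g /\
  forall s : M, same_integral (fun x => g x * cos (mxdot s x)) /\
                same_integral (fun x => g x * sin (mxdot s x)).

(** The quantification over all [g] makes products of multipliers immediate: they act one after the
    other. *)
Definition multiplier (f : T -> R) := bounded_measurable f /\
  forall g, same_transform g -> same_transform (fun x => f x * g x).

Lemma same_integralD f g : bounded_measurable f -> bounded_measurable g ->
  same_integral f -> same_integral g -> same_integral (fun x => f x + g x).
Proof. by move=> bf bg fE gE; rewrite /same_integral !Rintegral_bmD// fE gE. Qed.

Lemma same_integralZ r f : bounded_measurable f ->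
  same_integral f -> same_integral (fun x => r * f x).
Proof. by move=> bf fE; rewrite /same_integral !Rintegral_bmZ// fE. Qed.

Lemma eq_same_integral f g : f =1 g -> same_integral f -> same_integral g.
Proof. by move=> /funext ->. Qed.

Lemma eq_multiplier f g : f =1 g -> multiplier f -> multiplier g.
Proof. by move=> /funext ->. Qed.

Lemma same_transformD f g : same_transform f -> same_transform g ->
  same_transform (fun x => f x + g x).
Proof.
move=> [bf fE] [bg gE]; split; first exact: bounded_measurableD.
have bc := bounded_measurable_cos_mxdot; have bs := bounded_measurable_sin_mxdot.
move=> s; have [fc fs] := fE s; have [gc gs] := gE s; split.
- apply: eq_same_integral (same_integralD _ _ fc gc) => [x||]; first by rewrite mulrDl.
  + exact: bounded_measurableM.
  + exact: bounded_measurableM.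
- apply: eq_same_integral (same_integralD _ _ fs gs) => [x||]; first by rewrite mulrDl.
  + exact: bounded_measurableM.
  + exact: bounded_measurableM.
Qed.

Lemma same_transformZ r f : same_transform f -> same_transform (fun x => r * f x).
Proof.
move=> [bf fE]; split.
  by apply: bounded_measurableM => //; exact: bounded_measurable_cst.
have bc := bounded_measurable_cos_mxdot; have bs := bounded_measurable_sin_mxdot.
move=> s; have [fc fs] := fE s; split.
- apply: eq_same_integral (same_integralZ r _ fc) => [x|]; first by rewrite mulrA.
  exact: bounded_measurableM.
- apply: eq_same_integral (same_integralZ r _ fs) => [x|]; first by rewrite mulrA.
  exact: bounded_measurableM.
Qed.

Lemma multiplier_cst r : multiplier (fun=> r).
Proof. by split; [exact: bounded_measurable_cst|move=> g /(same_transformZ r)]. Qed.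

Lemma multiplierD f g : multiplier f -> multiplier g ->
  multiplier (fun x => f x + g x).
Proof.
move=> [bf fM] [bg gM]; split; first exact: bounded_measurableD.
move=> h hE; under eq_fun do rewrite mulrDl.
by apply: same_transformD; [exact: fM|exact: gM].
Qed.

Lemma multiplierM f g : multiplier f -> multiplier g ->
  multiplier (fun x => f x * g x).
Proof.
move=> [bf fM] [bg gM]; split; first exact: bounded_measurableM.
by move=> h hE; under eq_fun do rewrite -mulrA; apply/fM/gM.
Qed.

Lemma multiplierZ r f : multiplier f -> multiplier (fun x => r * f x).
Proof. exact/multiplierM/multiplier_cst. Qed.

Lemma multiplierB f g : multiplier f -> multiplier g ->
  multiplier (fun x => f x - g x).
Proof.
move=> fM gM; apply: eq_multiplier (multiplierD fM (multiplierZ (-1) gM)) => x.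
by rewrite mulN1r.
Qed.

(** Bounded convergence is applied under [P] and under [Q] to the same sequence of integrals, so the
    two limits coincide. *)
Lemma multiplier_cvg (h : nat -> T -> R) f (K : R) :
  (forall n, multiplier (h n)) -> (forall n x, `|h n x| <= K) ->
  (forall x, h n x @[n --> \oo] --> f x) -> multiplier f.
Proof.
move=> hM hK hf.
have mh n : measurable_fun setT (h n) by have [[]] := hM n.
have [bf _] := bounded_cvg_Rintegral P mh hK hf.
split=> // g gE; have [bg _] := gE; split; first exact: bounded_measurableM.
have [mg [N gN]] := bg.
have lim_same (e : T -> R) : bounded_measurable e ->
    (forall n, same_integral (fun x => h n x * g x * e x)) ->
    same_integral (fun x => f x * g x * e x).
  move=> [me [L eL]] hE.
  have mhge n : measurable_fun setT (fun x => h n x * g x * e x).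
    by apply: measurable_funM => //; exact: measurable_funM.
  have hgeK n x : `|h n x * g x * e x| <= K * N * L.
    by rewrite !normrM !ler_pM.
  have hgef x : h n x * g x * e x @[n --> \oo] --> f x * g x * e x.
    by apply: cvgM; [apply: cvgM => //; exact: cvg_cst|exact: cvg_cst].
  have [_ cP] := bounded_cvg_Rintegral P mhge hgeK hgef.
  have [_ cQ] := bounded_cvg_Rintegral Q mhge hgeK hgef.
  have PQ : (fun n => \int[P]_x (h n x * g x * e x)) =
            (fun n => \int[Q]_x (h n x * g x * e x)).
    by apply/funext => n; exact: hE.
  by rewrite PQ in cP; apply: (cvg_unique _ cP cQ).
move=> s; split.
- apply: (lim_same (fun x => cos (mxdot s x))).
    exact: bounded_measurable_cos_mxdot.
  by move=> n; have [_ /(_ _ gE)[_ /(_ s)[]]] := hM n.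
- apply: (lim_same (fun x => sin (mxdot s x))).
    exact: bounded_measurable_sin_mxdot.
  by move=> n; have [_ /(_ _ gE)[_ /(_ s)[]]] := hM n.
Qed.

(** The product-to-sum formulas turn multiplication by this cosine into an average over the
    frequencies [s + t] and [s - t], at which equality is known because [same_transform] covers
    every frequency. *)
Lemma multiplier_cos t : multiplier (fun x => cos (mxdot t x)).
Proof.
have bc := bounded_measurable_cos_mxdot; have bs := bounded_measurable_sin_mxdot.
split=> // g [bg gE]; split; first exact: bounded_measurableM.
move=> s; split.
- have [cD _] := gE (s + t); have [cB _] := gE (s - t).
  apply: eq_same_integral (same_integralZ (1 / 2) _ (same_integralD _ _ cD cB)).
  + by move=> x; rewrite !mxdotDl mxdotNl cosB cosD; field.
  + by apply: bounded_measurableD; exact: bounded_measurableM.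
  + exact: bounded_measurableM.
  + exact: bounded_measurableM.
- have [_ sD] := gE (s + t); have [_ sB] := gE (s - t).
  apply: eq_same_integral (same_integralZ (1 / 2) _ (same_integralD _ _ sD sB)).
  + by move=> x; rewrite !mxdotDl mxdotNl sinB sinD; field.
  + by apply: bounded_measurableD; exact: bounded_measurableM.
  + exact: bounded_measurableM.
  + exact: bounded_measurableM.
Qed.

Lemma multiplier_sin t : multiplier (fun x => sin (mxdot t x)).
Proof.
have bc := bounded_measurable_cos_mxdot; have bs := bounded_measurable_sin_mxdot.
split=> // g [bg gE]; split; first exact: bounded_measurableM.
move=> s; split.
- have [_ sD] := gE (t + s); have [_ sB] := gE (t - s).
  apply: eq_same_integral (same_integralZ (1 / 2) _ (same_integralD _ _ sD sB)).
  + by move=> x; rewrite !mxdotDl mxdotNl sinB sinD; field.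
  + by apply: bounded_measurableD; exact: bounded_measurableM.
  + exact: bounded_measurableM.
  + exact: bounded_measurableM.
- have [cD _] := gE (t + s); have [cB _] := gE (t - s).
  apply: eq_same_integral (same_integralZ (1 / 2) _
    (same_integralD _ _ cB (same_integralZ (-1) _ cD))).
  + by move=> x; rewrite !mxdotDl mxdotNl cosB cosD; field.
  + apply: bounded_measurableD; first exact: bounded_measurableM.
    apply: bounded_measurableM; first exact: bounded_measurable_cst.
    exact: bounded_measurableM.
  + exact: bounded_measurableM.
  + by apply: bounded_measurableM; [exact: bounded_measurable_cst|exact: bounded_measurableM].
  + exact: bounded_measurableM.
Qed.

Lemma multiplier_sg_coord i j a : multiplier (fun x : T => Num.sg ((x : M) i j - a)).
Proof.
have step f : multiplier f -> multiplier (fun x => sign_step (f x)).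
  move=> fM; apply: eq_multiplier (multiplierB (multiplierZ (3 / 2) fM)
    (multiplierZ (1 / 2) (multiplierM fM (multiplierM fM fM)))) => x.
  by rewrite /sign_step; field.
pose s n (x : T) := sin (n.+1%:R^-1 * ((x : M) i j - a)).
have sM n : multiplier (s n).
  (* This frequency isolates the entry [(i, j)]; the subtraction formula for the sine moves the
     shift [a] into constant coefficients. *)
  pose t : M := n.+1%:R^-1 *: delta_mx i j.
  apply: eq_multiplier (multiplierB
    (multiplierZ (cos (n.+1%:R^-1 * a)) (multiplier_sin t))
    (multiplierZ (sin (n.+1%:R^-1 * a)) (multiplier_cos t))) => x.
  by rewrite /s /t !mxdot_delta mulrBr sinB; ring.
have sgM n : multiplier (fun x => Num.sg (s n x)).
  apply: (multiplier_cvg (h := fun k x => iter k sign_step (s n x)) (K := 1)).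
  - by elim=> [|k IH]; [exact: sM|exact: step].
  - by move=> k x; apply: norm_iter_sign_step; exact: sin_max.
  - by move=> x; apply: cvg_iter_sign_step; exact: sin_max.
apply: (multiplier_cvg (h := fun k x => Num.sg (s k x)) (K := 1)) => // [n x|x].
  by rewrite normr_sg; case: eqP.
by apply: cvg_near_cst; exact: sg_sin_scaled.
Qed.

Lemma multiplier_halfspace i j a : multiplier (\1_[set x : T | a < (x : M) i j]).
Proof.
have sM := multiplier_sg_coord i j a.
(* With [s] the sign, [(s^2 + s) / 2] is [1] for [s = 1] and [0] for [s = 0] or [s = -1]. *)
apply: eq_multiplier (multiplierZ (1 / 2) (multiplierD (multiplierM sM sM) sM)) => x.
have memE : (x \in [set x : T | a < (x : M) i j]) = (0 < (x : M) i j - a).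
  by rewrite subr_gt0; apply/idP/idP => [/set_mem|/mem_set].
rewrite indicE memE; have [u0|u0|->] := ltrgt0P ((x : M) i j - a).
- by rewrite gtr0_sg//=; field.
- by rewrite ltr0_sg//=; field.
- by rewrite sgr0 /=; field.
Qed.

Let G : set (set T) := [set A | multiplier (\1_A)].

(** Complements and finite unions come from [1 - f] and [f + g - f g]; for a countable union, the
    indicators of the finite unions are eventually constant at each point. *)
Lemma multiplier_sigma_algebra : sigma_algebra setT G.
Proof.
have GC A : G A -> G (~` A).
  move=> GA; apply: eq_multiplier (multiplierB (multiplier_cst 1) GA) => x.
  by rewrite !indicE in_setC; case: (_ \in _) => /=; ring.
have GU A B : G A -> G B -> G (A `|` B).
  move=> GA GB; apply: eq_multiplier (multiplierB (multiplierD GA GB) (multiplierM GA GB)) => x.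
  by rewrite !indicE in_setU; do 2 case: (_ \in _) => /=; ring.
have G0 : G set0.
  by apply: eq_multiplier (multiplier_cst 0) => x; rewrite indicE in_set0.
split=> // [A|A GA]; first by rewrite setTD; exact: GC.
apply: (multiplier_cvg (h := fun n => \1_(\big[setU/set0]_(i < n) A i)) (K := 1)).
- by move=> n; exact: (big_ind G G0 GU).
- by move=> n x; rewrite indicE; case: (_ \in _); rewrite ?normr1 ?normr0.
move=> x; apply: cvg_near_cst; have [[n _ Anx]|nAx] := pselect ((\bigcup_n A n) x).
  exists n.+1 => // m /= nm; rewrite !indicE !mem_set//; first by exists n.
  by rewrite -bigcup_mkord; exists n.
apply: nearW => n; rewrite !indicE !memNset//.
by rewrite -bigcup_mkord => -[k _ Akx]; apply: nAx; exists k.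
Qed.

Lemma multiplier_indic (A : set T) : measurable A -> multiplier (\1_A).
Proof.
move=> mA; have sG := multiplier_sigma_algebra.
suff : [set A | multiplier (\1_A)] A by [].
apply: mA; split=> // U oU.
rewrite -/G -(measurable_g_measurableTypeE sG).
(* The identity map out of the space equipped with [G] has measurable coordinates because [G]
   contains the half-spaces; hence [G] contains the open sets. *)
apply: (@measurable_preimage_open R d p _ (g_sigma_algebraType G) id) => //.
move=> i j; apply: (measurability _ (RGenOInfty.measurableE R)).
move=> _ [_ [c ->] <-]; rewrite setTI preimage_itvoy.
by rewrite (measurable_g_measurableTypeE sG); exact: multiplier_halfspace.
Qed.

(** Equality of characteristic functions says that the constant [1] has the same transform;
    multiplying by the indicator of [A] and taking frequency [0] compares the masses of [A]. *)
Lemma char_fun_inj : char_fun P =1 char_fun Q -> same_law P Q.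
Proof.
move=> PQ A mA.
have one : same_transform (fun=> 1).
  split; first exact: bounded_measurable_cst.
  move=> s; have := PQ s; rewrite /char_fun /Cintegral => -[Ec Es].
  by split; rewrite /same_integral; under [LHS]eq_Rintegral do rewrite mul1r;
    under [RHS]eq_Rintegral do rewrite mul1r.
have [_ /(_ 0)[+ _]] := (multiplier_indic mA).2 _ one.
rewrite /same_integral.
under eq_Rintegral do rewrite mulr1 mxdot0l cos0 mulr1.
under [RHS]eq_Rintegral do rewrite mulr1 mxdot0l cos0 mulr1.
rewrite !Rintegral_indic_probability// => PQA.
by rewrite -[LHS]fineK ?fin_num_measure// PQA fineK// fin_num_measure.
Qed.

End CharacteristicFunctionUniqueness.

(** * Convergence of empirical characteristic functions *)

Section EmpiricalMeans.
Context {dT} {T : measurableType dT} {R : realType} (Q : probability T R).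
Variables (x : nat -> T) (c : T -> nat).
Hypothesis mc : forall k, measurable [set y | c y = k].

(** The sequence [x] is deterministic in this section: it stands for one outcome of the sample,
    about which only the limiting frequencies of the classes [c y = k] are assumed. *)
Definition empirical_mean (f : T -> R) n : R := n%:R^-1 * \sum_(j < n) f (x j).

Hypothesis freq_cvg : forall k,
  empirical_mean (\1_[set y | c y = k]) n @[n --> \oo] -->
  fine (Q [set y | c y = k]).

Lemma sum_indic_fibre (v : nat -> R) N y :
  \sum_(k < N) v k * \1_[set y | c y = k] y = if (c y < N)%N then v (c y) else 0.
Proof.
have indE k : \1_[set y | c y = k] y = (c y == k)%:R :> R.
  by rewrite indicE; congr (nat_of_bool _)%:R; apply/idP/eqP => [/set_mem|/mem_set].
case: ifPn => [cN|cN].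
  rewrite (bigD1 (Ordinal cN))//= indE eqxx mulr1 big1 ?addr0// => k kc.
  rewrite indE; case: eqP => [ck|_]; last by rewrite mulr0.
  by move: kc; rewrite -val_eqE /= ck eqxx.
rewrite big1// => k _; rewrite indE; case: eqP => [ck|_]; last by rewrite mulr0.
by move: cN; rewrite ck ltn_ord.
Qed.

Let g (v : nat -> R) N y : R := \sum_(k < N) v k * \1_[set y | c y = k] y.

Lemma bounded_measurable_fibre_sum v N : bounded_measurable (g v N).
Proof.
apply: bounded_measurable_sum => k; apply: bounded_measurableM.
  exact: bounded_measurable_cst.
exact: bounded_measurable_indic.
Qed.

Lemma empirical_fibre_sum_cvg v N :
  empirical_mean (g v N) n @[n --> \oo] --> \int[Q]_y g v N y.
Proof.
have -> : empirical_mean (g v N) =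
    fun n => \sum_(k < N) v k * empirical_mean (\1_[set y | c y = k]) n.
  apply/funext => n; rewrite /empirical_mean exchange_big mulr_sumr.
  by apply: eq_bigr => k _; rewrite -mulr_sumr mulrCA.
have bI k : bounded_measurable (\1_[set y | c y = k] : T -> R).
  exact: bounded_measurable_indic.
rewrite Rintegral_bm_sum => [|k]; last first.
  by apply: bounded_measurableM => //; exact: bounded_measurable_cst.
apply: cvg_bigsum => k; rewrite Rintegral_bmZ// Rintegral_indic_probability//.
by apply: cvgM; [exact: cvg_cst|exact: freq_cvg].
Qed.

Arguments empirical_fibre_sum_cvg : clear implicits.

(** Up to [e], [f] is a step function on the first [N] classes; elsewhere it is bounded by [K]. The
    error is at most [e + 2 K e] for the empirical mean, [e + K e] for the integral, and [e] between
    the means of the step function. *)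
Lemma empirical_mean_near (f : T -> R) (K e : R) :
  bounded_measurable f -> (forall y, `|f y| <= K) -> 0 < e ->
  (forall y z, c y = c z -> `|f y - f z| <= e) ->
  \forall n \near \oo, `|empirical_mean f n - \int[Q]_y f y| <= (3 + 3 * K) * e.
Proof.
move=> bf fK e0 osc; have K0 : 0 <= K by exact: le_trans (fK (x 0)).
(* The value of [f] at a chosen point of class [k], with default [0] for an empty class. *)
pose v k : R := if pselect (exists y, c y = k) is left ey then f (projT1 (cid ey)) else 0.
(* The indicator of the first [N] classes, so that [1 - h N] measures the tail. *)
pose h N := g (fun=> 1) N.
have hE N y : h N y = if (c y < N)%N then 1 else 0 by exact: sum_indic_fibre.
have fg N y : `|f y - g v N y| <= e + K * (1 - h N y).
  rewrite hE /g sum_indic_fibre; case: ifPn => _; last first.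
    by rewrite !subr0 mulr1 (le_trans (fK y))// lerDr ltW.
  rewrite subrr mulr0 addr0 /v; case: pselect => [ey|[]]; last by exists y.
  by apply: osc; case: cid => z /= ->.
have bh N : bounded_measurable (h N) by exact: bounded_measurable_fibre_sum.
have bg N : bounded_measurable (g v N) by exact: bounded_measurable_fibre_sum.
(* The classes exhaust the space, so finitely many of them carry all but [e] of the mass of [Q]. *)
have [N hN] : exists N, 1 - e <= \int[Q]_y h N y.
  have mh N : measurable_fun setT (h N) by have [] := bh N.
  have h1 N y : `|h N y| <= 1 by rewrite hE; case: ifPn; rewrite ?normr1 ?normr0.
  have hc y : h N y @[N --> \oo] --> (1 : R).
    by apply: cvg_near_cst; exists (c y).+1 => // N /=; rewrite hE => ->.
  have [_] := bounded_cvg_Rintegral Q mh h1 hc.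
  rewrite Rintegral_probability_cst => /cvgrPdist_le /(_ _ e0)[N _ HN].
  by exists N; have := HN N (leqnn N); rewrite ler_norml; lra.
have bd : bounded_measurable (fun y => e + K * (1 - h N y)).
  apply: bounded_measurableD; first exact: bounded_measurable_cst.
  apply: bounded_measurableM; first exact: bounded_measurable_cst.
  by apply: bounded_measurableB => //; exact: bounded_measurable_cst.
have dQ : \int[Q]_y (e + K * (1 - h N y)) = e + K * (1 - \int[Q]_y h N y).
  rewrite Rintegral_bmD ?Rintegral_bmZ ?Rintegral_bmB ?Rintegral_probability_cst//;
    try exact: bounded_measurable_cst.
  - by apply: bounded_measurableB => //; exact: bounded_measurable_cst.
  - apply: bounded_measurableM; first exact: bounded_measurable_cst.
    by apply: bounded_measurableB => //; exact: bounded_measurable_cst.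
have fgQ : `|\int[Q]_y f y - \int[Q]_y g v N y| <= e + K * (1 - \int[Q]_y h N y).
  rewrite -dQ -Rintegral_bmB// ler_norml; apply/andP; split.
    rewrite lerNl -mulN1r -Rintegral_bmZ; last exact: bounded_measurableB.
    apply: le_Rintegral_bm => // [|y].
      apply: bounded_measurableM; first exact: bounded_measurable_cst.
      exact: bounded_measurableB.
    by rewrite mulN1r lerNl; have := fg N y; rewrite ler_norml => /andP[].
  apply: le_Rintegral_bm => // [|y]; first exact: bounded_measurableB.
  by have := fg N y; rewrite ler_norml => /andP[].
have near_g u : \forall n \near \oo,
    `|\int[Q]_y g u N y - empirical_mean (g u N) n| <= e.
  have /cvgrPdist_le := empirical_fibre_sum_cvg u N.
  by apply.
have near_h := near_g (fun=> 1); have {}near_g := near_g v.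
near=> n.
have n0 : 0 < n%:R :> R by rewrite ltr0n; near: n; exact: nbhs_infty_gt.
have hn : `|\int[Q]_y h N y - empirical_mean (h N) n| <= e by near: n.
have gn : `|\int[Q]_y g v N y - empirical_mean (g v N) n| <= e by near: n.
have fgn : `|empirical_mean f n - empirical_mean (g v N) n| <=
    e + K * (1 - empirical_mean (h N) n).
  have -> : empirical_mean f n - empirical_mean (g v N) n =
      n%:R^-1 * \sum_(j < n) (f (x j) - g v N (x j)).
    by rewrite sumrB mulrBr.
  have -> : e + K * (1 - empirical_mean (h N) n) =
      n%:R^-1 * \sum_(j < n) (e + K * (1 - h N (x j))).
    rewrite big_split /= -mulr_sumr sumrB !sumr_const card_ord /empirical_mean.
    by rewrite -[e *+ n]mulr_natl; field; lra.
  rewrite normrM (@ger0_norm _ n%:R^-1) ?invr_ge0// ler_pM2l ?invr_gt0//.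
  by rewrite (le_trans (ler_norm_sum _ _ _))//; apply: ler_sum => j _.
have : `|empirical_mean f n - \int[Q]_y f y| <=
    `|empirical_mean f n - empirical_mean (g v N) n| +
    `|\int[Q]_y g v N y - empirical_mean (g v N) n| +
    `|\int[Q]_y f y - \int[Q]_y g v N y|.
  have -> : empirical_mean f n - \int[Q]_y f y =
    (empirical_mean f n - empirical_mean (g v N) n) -
    (\int[Q]_y g v N y - empirical_mean (g v N) n) -
    (\int[Q]_y f y - \int[Q]_y g v N y) by ring.
  by rewrite (le_trans (ler_normB _ _))// lerD2r ler_normB.
(* The empirical tail exceeds the tail under [Q], at most [e], by at most another [e]. *)
have : K * (1 - empirical_mean (h N) n) <= K * (2 * e).
  by rewrite ler_wpM2l//; move: hn; rewrite ler_norml; lra.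
have : K * (1 - \int[Q]_y h N y) <= K * e by rewrite ler_wpM2l//; lra.
lra.
Unshelve. all: by end_near. Qed.

End EmpiricalMeans.

(** * Partition of the space into small cubes *)

Section Cubes.
Context {R : realType} {d p : nat}.
Local Notation M := 'M[R]_(d, p).

(** The integer matrix locating the half-open cube of side [1 / (m+1)] that contains [x], coded as a
    natural number so that the cubes form a sequence. *)
Definition cube_index (m : nat) (x : M) : nat :=
  choice.pickle (\matrix_(i, j) Num.floor (m.+1%:R * x i j)).

Lemma cube_index_close m (x y : M) : cube_index m x = cube_index m y ->
  forall i j, `|x i j - y i j| <= m.+1%:R^-1.
Proof.
move=> /(pcan_inj choice.pickleK)/matrixP xy i j.
have := xy i j; rewrite !mxE => fxy.
have m0 : 0 < m.+1%:R :> R by rewrite ltr0n.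
rewrite -(ler_pM2l m0) divff ?gt_eqF// -[X in X * _]gtr0_norm// -normrM mulrBr.
have := floor_itv (m.+1%:R * x i j); have := floor_itv (m.+1%:R * y i j).
by rewrite fxy intrD ler_norml => /andP[? ?] /andP[? ?]; lra.
Qed.

Lemma measurable_cube m k :
  measurable [set x : borel_mx R d p | cube_index m x = k].
Proof.
case kz : (@choice.unpickle 'M[int]_(d, p) k) => [z|]; last first.
  rewrite (_ : [set _ | _] = set0); first exact: measurable0.
  by apply/seteqP; split=> // x /= xk; move: kz; rewrite -xk choice.pickleK.
have m0 : 0 < m.+1%:R :> R by rewrite ltr0n.
(* Decoding may succeed on a number that is not the code of its result; such a number indexes no
   cube. *)
have [kz'|kz'] := eqVneq (choice.pickle z) k; last first.
  rewrite (_ : [set _ | _] = set0); first exact: measurable0.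
  apply/seteqP; split=> // x /= xk; move: kz kz'; rewrite -xk choice.pickleK.
  by move=> [<-]; rewrite eqxx.
have -> : [set x : borel_mx R d p | cube_index m x = k] =
    \bigcap_(ij in [set: 'I_d * 'I_p])
    ((fun x : borel_mx R d p => (x : M) ij.1 ij.2) @^-1`
       `[(z ij.1 ij.2)%:~R / m.+1%:R, (z ij.1 ij.2 + 1)%:~R / m.+1%:R[).
  apply/seteqP; split=> x /=.
    rewrite -kz' => /(pcan_inj choice.pickleK)/matrixP xz [i j] _ /=.
    have := xz i j; rewrite mxE => /eqP; rewrite floor_eq in_itv /=.
    by rewrite ler_pdivrMr// ltr_pdivlMr// mulrC.
  move=> xz; rewrite -kz' /cube_index; congr choice.pickle.
  apply/matrixP => i j; rewrite mxE; apply/eqP; rewrite floor_eq.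
  by have := xz (i, j) I; rewrite /= in_itv /= ler_pdivrMr// ltr_pdivlMr// mulrC.
apply: fin_bigcap_measurable => [|[i j] _]; first exact: finite_finset.
have H := @measurable_borel_coord R d p i j measurableT _ (measurable_itv
  `[(z i j)%:~R / m.+1%:R, (z i j + 1)%:~R / m.+1%:R[).
by rewrite setTI in H; exact: H.
Qed.

Lemma mxdot_close (t x y : M) (e : R) : (forall i j, `|x i j - y i j| <= e) ->
  `|mxdot t x - mxdot t y| <= (\sum_ij `|t ij.1 ij.2|) * e.
Proof.
move=> xy; rewrite !mxdotE -sumrB (le_trans (ler_norm_sum _ _ _))// mulr_suml.
by apply: ler_sum => ij _; rewrite -mulrBr normrM ler_wpM2l.
Qed.

(** The function [phi] will be the cosine and the sine; being Lipschitz, it oscillates little on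
    fine cubes. The hypothesis on frequencies does not mention [t], hence the conclusion holds for
    all [t] at once. *)
Lemma empirical_char_cvg (Q : probability (borel_mx R d p) R)
    (x : nat -> borel_mx R d p) (phi : R -> R) :
  (forall a b, `|phi a - phi b| <= `|a - b|) -> (forall a, `|phi a| <= 1) ->
  (forall t : M, bounded_measurable (fun y : borel_mx R d p => phi (mxdot t y))) ->
  (forall m k, empirical_mean x (\1_[set y | cube_index m y = k]) n @[n --> \oo]
     --> fine (Q [set y | cube_index m y = k])) ->
  forall t : M, empirical_mean x (fun y => phi (mxdot t y)) n @[n --> \oo] -->
    \int[Q]_y phi (mxdot t y).
Proof.
move=> phi_lip phi1 bphi freq t; apply/cvgrPdist_le => e e0.
(* The bound [(3 + 3 K) e] is used with [K = 1]. *)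
have e6 : 0 < e / 6 by lra.
pose C : R := \sum_ij `|t ij.1 ij.2|.
have C0 : 0 <= C by exact: sumr_ge0.
have [m Cm] : exists m : nat, C / (e / 6) <= m.+1%:R.
  by exists (Num.truncn (C / (e / 6))); apply/ltW/truncnS_gt.
have osc (y z : borel_mx R d p) : cube_index m y = cube_index m z ->
    `|phi (mxdot t y) - phi (mxdot t z)| <= e / 6.
  move=> /cube_index_close/(mxdot_close t) yz.
  rewrite (le_trans (phi_lip _ _))// (le_trans yz)// -/C.
  by rewrite ler_pdivrMr ?ltr0n// mulrC -ler_pdivrMr.
have := empirical_mean_near (measurable_cube m) (freq m) (bphi t)
  (fun y => phi1 (mxdot t y)) e6 osc.
apply: filterS => n; rewrite distrC => /le_trans; apply; lra.
Qed.
End Cubes.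

Lemma eq_Rintegral_measure {dT} {T : measurableType dT} {R : realType}
    (P Q : {measure set T -> \bar R}) (f : T -> R) :
  same_law P Q -> \int[P]_x f x = \int[Q]_x f x.
Proof. by move=> PQ; congr fine; apply: eq_measure_integral => A mA _; exact: PQ. Qed.

(** * Continuity of characteristic functions *)

Section ContinuityUnderIntegral.
Context {R : realType} {d p : nat} {dT} {T : measurableType dT}.
Variable Q : probability T R.

(** A discontinuity at [t] would give points [s n] within [1 / (n+1)] of [t] whose integrals stay at
    distance at least [e], against bounded convergence. *)
Lemma continuous_Rintegral (f : 'M[R]_(d, p) -> T -> R) (K : R) :
  (forall t, measurable_fun setT (f t)) -> (forall t x, `|f t x| <= K) ->
  (forall x, continuous (f^~ x)) -> continuous (fun t => \int[Q]_x f t x).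
Proof.
move=> mf fK cf t; apply/(@cvgrPdist_lt _ _ _ (nbhs t)) => e e0; apply: contrapT => nnear.
have far n : exists s, ball t n.+1%:R^-1 s /\
    e <= `|\int[Q]_x f t x - \int[Q]_x f s x|.
  apply: contrapT => nex; apply: nnear; apply/nbhs_ballP.
  exists n.+1%:R^-1; first by rewrite /= invr_gt0.
  by move=> s ts; rewrite ltNge; apply/negP => es; apply: nex; exists s.
have [s ts] := choice far.
have st : s n @[n --> \oo] --> t.
  apply/cvg_ballP => r r0.
  have [n _ Hn] := near_infty_natSinv_lt (PosNum r0).
  exists n => // k /= nk; apply: le_ball (ts k).1.
  exact/ltW/Hn.
have fst x : f (s n) x @[n --> \oo] --> f t x.
  exact: (cvg_comp _ _ st (cf x t)).
have [_ /cvgrPdist_lt /(_ _ e0)[N _ /(_ N (leqnn N))]] :=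
  bounded_cvg_Rintegral Q (fun n => mf (s n)) (fun n => fK (s n)) fst.
by rewrite /= ltNge (ts N).2.
Qed.
End ContinuityUnderIntegral.

Section CharacteristicFunctions.
Context {R : realType} {d p : nat}.
Local Notation M := 'M[R]_(d, p).
Local Notation T := (borel_mx R d p).
Implicit Types (Q : probability T R) (t : M).

Definition cos_transform Q t := \int[Q]_x cos (mxdot t x).
Definition sin_transform Q t := \int[Q]_x sin (mxdot t x).

Lemma continuous_cos_transform Q : continuous (cos_transform Q).
Proof.
apply: (continuous_Rintegral (f := fun t (x : T) => cos (mxdot t x)) (K := 1)).
- by move=> t; have [] := bounded_measurable_cos_mxdot t.
- by move=> t x; exact: cos_max.
- by move=> x t; apply: continuous_comp; [exact: continuous_mxdotl|exact: continuous_cos].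
Qed.

Lemma continuous_sin_transform Q : continuous (sin_transform Q).
Proof.
apply: (continuous_Rintegral (f := fun t (x : T) => sin (mxdot t x)) (K := 1)).
- by move=> t; have [] := bounded_measurable_sin_mxdot t.
- by move=> t x; exact: sin_max.
- by move=> x t; apply: continuous_comp; [exact: continuous_mxdotl|exact: continuous_sin].
Qed.

(* The variance of exp(i tr(t'x)) is nonnegative. *)
Lemma transform_sqr_le1 Q t : cos_transform Q t ^+ 2 + sin_transform Q t ^+ 2 <= 1.
Proof.
pose a := cos_transform Q t; pose b := sin_transform Q t; rewrite -/a -/b.
have bc := bounded_measurable_cos_mxdot t.
have bs := bounded_measurable_sin_mxdot t.
have bac : bounded_measurable (fun x : T => a * cos (mxdot t x)).
  by apply: bounded_measurableM => //; exact: bounded_measurable_cst.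
have bbs : bounded_measurable (fun x : T => b * sin (mxdot t x)).
  by apply: bounded_measurableM => //; exact: bounded_measurable_cst.
have -> : a ^+ 2 + b ^+ 2 =
    \int[Q]_x (a * cos (mxdot t x) + b * sin (mxdot t x)).
  by rewrite Rintegral_bmD// !Rintegral_bmZ.
have : \int[Q]_x (a * cos (mxdot t x) + b * sin (mxdot t x)) <=
    \int[Q]_x ((a ^+ 2 + b ^+ 2 + 1) / 2).
  apply: le_Rintegral_bm => [||x].
  - exact: bounded_measurableD.
  - exact: bounded_measurable_cst.
  have := cos2Dsin2 (mxdot t x).
  have := sqr_ge0 (a - cos (mxdot t x)); have := sqr_ge0 (b - sin (mxdot t x)).
  nra.
rewrite Rintegral_probability_cst Rintegral_bmD// !Rintegral_bmZ//.
rewrite -/(cos_transform Q t) -/(sin_transform Q t) -/a -/b; lra.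
Qed.

Lemma emp_char_funE n (x : nat -> T) t : emp_char_fun n x t =
  Complex (empirical_mean x (fun y => cos (mxdot t y)) n)
          (empirical_mean x (fun y => sin (mxdot t y)) n).
Proof.
rewrite /emp_char_fun /empirical_mean.
have -> : \sum_(j < n) expi (\tr (t^T *m x j)) =
    Complex (\sum_(j < n) cos (mxdot t (x j))) (\sum_(j < n) sin (mxdot t (x j))).
  elim: n => [|n IH]; first by rewrite !big_ord0.
  by rewrite !big_ord_recr /= IH.
have -> : n%:R^-1 = (n%:R^-1)%:C%C :> R[i] by rewrite fmorphV rmorph_nat.
by simpc.
Qed.

Lemma char_funE Q t : char_fun Q t = Complex (cos_transform Q t) (sin_transform Q t).
Proof. by []. Qed.

Lemma sqr_normc_sub (a b a' b' : R) :
  ComplexField.Normc.normc (Complex a b - Complex a' b') ^+ 2 =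
  (a - a') ^+ 2 + (b - b') ^+ 2.
Proof. by rewrite /= sqr_sqrtr// addr_ge0// sqr_ge0. Qed.

End CharacteristicFunctions.

(** * Almost sure convergence at all frequencies *)

Section AlmostSureConvergence.
Context {R : realType} {d p : nat} {dO} {Omega : measurableType dO}.
Local Notation M := 'M[R]_(d, p).
Local Notation T := (borel_mx R d p).
Variables (Pr : probability Omega R) (P : probability T R) (X : nat -> {RV Pr >-> T}).
Hypothesis X_indep : mutually_independent X.
Hypothesis X_law : forall j, same_law (distribution Pr (X j)) P.

Lemma ae_frequency_cvg (B : set T) : measurable B ->
  {ae Pr, forall omega, empirical_mean (X^~ omega) (\1_B) n @[n --> \oo] --> fine (P B)}.
Proof.
move=> mB.
have mXB j : measurable (X j @^-1` B) by exact: measurable_funPTI.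
have PXB j : Pr (X j @^-1` B) = (fine (P B))%:E.
  by rewrite fineK ?fin_num_measure//; exact: X_law.
have := strong_law_events mXB PXB.
apply => i j ij.
(* Pairwise independence is mutual independence on a two-element index set, with the same event [B]
   for each index. *)
have := X_indep [fset i; j]%fset (fun=> mB).
rewrite big_fsetU1 ?inE//= big_seq_fset1 !PXB -EFinM => <-.
congr (Pr _); apply/seteqP; split=> [w [Bi Bj] k /=|w Bw].
  by rewrite !inE => /orP[]/eqP->.
by split; apply: Bw; rewrite /= !inE eqxx ?orbT.
Qed.

(** The exceptional null set is a countable union over meshes and cubes, and so does not depend on
    [t]. *)
Lemma ae_empirical_char_cvg : {ae Pr, forall omega, forall t : M,
  empirical_mean (X^~ omega) (fun y => cos (mxdot t y)) n @[n --> \oo]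
    --> cos_transform P t /\
  empirical_mean (X^~ omega) (fun y => sin (mxdot t y)) n @[n --> \oo]
    --> sin_transform P t}.
Proof.
have : {ae Pr, forall omega, forall m k,
    empirical_mean (X^~ omega) (\1_[set y | cube_index m y = k]) n @[n --> \oo]
    --> fine (P [set y | cube_index m y = k])}.
  apply: ae_foralln => m; apply: ae_foralln => k.
  exact: (ae_frequency_cvg (@measurable_cube R d p m k)).
apply: filterS => omega freq t; split.
- apply: empirical_char_cvg => //; [exact: cos_lipschitz|exact: cos_max|].
  exact: bounded_measurable_cos_mxdot.
- apply: empirical_char_cvg => //; [exact: sin_lipschitz|exact: sin_max|].
  exact: bounded_measurable_sin_mxdot.
Qed.
End AlmostSureConvergence.

(** * The limit of the test statistic *)

Section WeightedDistance.
Context {R : realType} {d p : nat}.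
Local Notation M := 'M[R]_(d, p).
Local Notation T := (borel_mx R d p).
Local Notation mu := (@lebesgue_mx_measure R d p).
Variables (w : M -> R) (w_density : is_lebesgue_density w).

Let mw : measurable_fun setT (w : lebesgue_mx R d p -> R).
Proof. by case: w_density. Qed.

Let w0 t : 0 <= w t.
Proof. by case: w_density. Qed.

Let w1 : (\int[mu]_t (w t)%:E = 1)%E.
Proof. by case: w_density. Qed.

(** The squared modulus of the difference of [a + i b] and [a' + i b']. *)
Definition sqr_dist (a b a' b' : M -> R) t : R :=
  (a t - a' t) ^+ 2 + (b t - b' t) ^+ 2.

Lemma continuous_sqr_dist a b a' b' : continuous a -> continuous b ->
  continuous a' -> continuous b' -> continuous (sqr_dist a b a' b').
Proof.
have sqrB (u v : M -> R) : continuous u -> continuous v ->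
    continuous (fun t => (u t - v t) ^+ 2).
  move=> cu cv t; apply: (@cvg_comp _ _ _ (fun t => u t - v t) (fun y : R => y ^+ 2)
    _ (nbhs (u t - v t)));
    [exact: cvgB (cu t) (cv t)|exact: exprn_continuous].
by move=> ca cb ca' cb' t; exact: (cvgD (sqrB _ _ ca ca' t) (sqrB _ _ cb cb' t)).
Qed.

Lemma integrable_density K : mu.-integrable setT (fun t => (K * w t)%:E).
Proof.
have iw : mu.-integrable setT (EFin \o w).
  apply/integrableP; split; first exact/measurable_EFinP.
  under eq_integral => t _ do rewrite /= ger0_norm//.
  by rewrite w1 ltry.
have := integrableZl measurableT K iw.
by under eq_fun do rewrite -EFinM.
Qed.

Lemma integral_density K : 0 <= K -> (\int[mu]_t (K * w t)%:E = K%:E)%E.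
Proof.
move=> K0; under eq_integral do rewrite EFinM.
rewrite ge0_integralZl_EFin//; first by rewrite w1 mule1.
- by move=> t _; rewrite lee_fin.
- exact/measurable_EFinP.
Qed.

Lemma not_null_open (U : set M) : open U -> U !=set0 -> lebesgue_outer U <> 0%E.
Proof.
move=> oU Un0 /(lebesgue_outer_open_null oU Un0) null.
have : (\int[mu]_t (w t)%:E = \int[mu]_t (cst 0%E t))%E.
  apply: ae_eq_integral => //; first exact/measurable_EFinP.
  exact: measure0_ae.
by rewrite w1 integral0 => /eqP; rewrite eqe oner_eq0.
Qed.
End WeightedDistance.

(** * Convergence of the statistic and bounds for its limit *)

Section TestStatistic.
Context {R : realType} {d p : nat}.
Local Notation M := 'M[R]_(d, p).
Local Notation T := (borel_mx R d p).
Local Notation mu := (@lebesgue_mx_measure R d p).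
Variables (w : M -> R) (w_density : is_lebesgue_density w).
Variables P0 : probability T R.

Let mw : measurable_fun setT (w : lebesgue_mx R d p -> R).
Proof. by case: w_density. Qed.

Let w0 t : 0 <= w t.
Proof. by case: w_density. Qed.

Let char_dist (P : probability T R) :=
  sqr_dist (cos_transform P) (sin_transform P) (cos_transform P0) (sin_transform P0).

Let continuous_char_dist P : continuous (char_dist P).
Proof.
by apply: continuous_sqr_dist; (exact: continuous_cos_transform ||
  exact: continuous_sin_transform).
Qed.

(** The almost sure limit of the test statistic for a sample from [P]. *)
Definition limit_stat (P : probability T R) : \bar R :=
  (\int[mu]_t (char_dist P t * w t)%:E)%E.

Lemma continuous_empirical_mean (phi : R -> R) (x : nat -> T) n :
  continuous phi -> continuous (fun t : M => empirical_mean x (fun y => phi (mxdot t y)) n).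
Proof.
move=> cphi t.
have cj (j : 'I_n) : {for t, continuous (fun s : M => phi (mxdot s (x j)))}.
  by apply: continuous_comp; [exact: continuous_mxdotl|exact: cphi].
have cS := @cvg_bigsum R _ (nbhs t) (nbhs_filter t) _ (index_enum 'I_n) _ _ cj.
rewrite /empirical_mean /continuous_at.
exact: cvgMl_tmp cS.
Qed.

Lemma norm_empirical_mean_le1 (f : T -> R) (x : nat -> T) n :
  (forall y, `|f y| <= 1) -> `|empirical_mean x f n| <= 1.
Proof.
move=> f1; have [->|n0] := posnP n.
  by rewrite /empirical_mean big_ord0 mulr0 normr0.
rewrite normrM (@ger0_norm _ n%:R^-1) ?invr_ge0// mulrC ler_pdivrMr ?ltr0n// mul1r.
rewrite (le_trans (ler_norm_sum _ _ _))// (le_trans (ler_sum _ (fun j _ => f1 _)))//.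
by rewrite sumr_const card_ord.
Qed.

Lemma norm_transform_le1 (Q : probability T R) t :
  `|cos_transform Q t| <= 1 /\ `|sin_transform Q t| <= 1.
Proof.
have := transform_sqr_le1 Q t.
move: (cos_transform Q t) (sin_transform Q t) => a b ab.
by split; rewrite ler_norml; apply/andP; split; nra.
Qed.

Lemma test_stat_cvg (P : probability T R) (x : nat -> T) :
  (forall t : M,
    empirical_mean x (fun y => cos (mxdot t y)) n @[n --> \oo] --> cos_transform P t /\
    empirical_mean x (fun y => sin (mxdot t y)) n @[n --> \oo] --> sin_transform P t) ->
  test_stat w P0 x n @[n --> \oo] --> limit_stat P.
Proof.
move=> cx.
pose dn n := sqr_dist (fun t => empirical_mean x (fun y => cos (mxdot t y)) n)
  (fun t => empirical_mean x (fun y => sin (mxdot t y)) n)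
  (cos_transform P0) (sin_transform P0).
have -> : test_stat w P0 x = fun n => (\int[mu]_t (dn n t * w t)%:E)%E.
  apply/funext => n; apply: eq_integral => t _.
  by rewrite emp_char_funE char_funE sqr_normc_sub.
have cdn n : continuous (dn n).
  apply: continuous_sqr_dist.
  - by apply: continuous_empirical_mean; exact: continuous_cos.
  - by apply: continuous_empirical_mean; exact: continuous_sin.
  - exact: continuous_cos_transform.
  - exact: continuous_sin_transform.
(* The factor [8] is crude but sufficient: real and imaginary parts lie between [-1] and [1], so
   each squared difference is at most [4]. *)
apply: (@dominated_cvg _ _ _ mu setT measurableT (fun n t => (dn n t * w t)%:E)
  (fun t => (char_dist P t * w t)%:E) (fun t => (8 * w t)%:E)) => //.
- move=> n; apply/measurable_EFinP; apply: measurable_funM => //.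
  exact: measurable_lebesgue_continuous (cdn n).
- move=> t _; apply: cvg_EFin; first exact: nearW.
  have [ct st] := cx t; apply: cvgM; last exact: cvg_cst.
  have sqrB (u : nat -> R) (a b : R) : u n @[n --> \oo] --> a ->
      (u n - b) ^+ 2 @[n --> \oo] --> (a - b) ^+ 2.
    move=> ua; have uab : u n - b @[n --> \oo] --> a - b.
      by apply: cvgB => //; exact: cvg_cst.
    exact: (cvg_comp _ _ uab (@exprn_continuous R 2 (a - b))).
  exact: cvgD (sqrB _ _ _ ct) (sqrB _ _ _ st).
- exact: integrable_density.
- move=> n t _; rewrite lee_fin ger0_norm; last first.
    by rewrite mulr_ge0// addr_ge0// sqr_ge0.
  rewrite ler_wpM2r// /dn /sqr_dist.
  have [] := norm_transform_le1 P0 t.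
  have := norm_empirical_mean_le1 x n (fun y => cos_max (mxdot t y)).
  have := norm_empirical_mean_le1 x n (fun y => sin_max (mxdot t y)).
  set a := empirical_mean _ _ _; set b := empirical_mean _ _ _.
  rewrite !ler_norml => /andP[? ?] /andP[? ?] /andP[? ?] /andP[? ?]; nra.
Qed.

Lemma limit_stat_same (P : probability T R) : same_law P P0 -> limit_stat P = 0%E.
Proof.
move=> PP0; rewrite /limit_stat -[RHS](integral0 mu setT).
apply: eq_integral => t _; rewrite /char_dist /sqr_dist /cos_transform /sin_transform.
by rewrite !(eq_Rintegral_measure _ PP0) !subrr !expr0n /= addr0 mul0r.
Qed.

(** By the parallelogram law the squared distance of two points of the unit disc is at most [4], and
    [w] has integral [1]. *)
Lemma limit_stat_le4 (P : probability T R) : (limit_stat P <= 4%:E)%E.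
Proof.
rewrite -(integral_density w_density (K := 4))//.
apply: ge0_le_integral => //.
- by move=> t _; rewrite lee_fin mulr_ge0// addr_ge0// sqr_ge0.
- apply/measurable_EFinP; apply: measurable_funM => //.
  exact: measurable_lebesgue_continuous (@continuous_char_dist P).
- by apply/measurable_EFinP; apply: measurable_funM => //.
move=> t _; rewrite lee_fin ler_wpM2r// /char_dist /sqr_dist.
have := transform_sqr_le1 P t; have := transform_sqr_le1 P0 t.
move: (cos_transform P t) (cos_transform P0 t) (sin_transform P t) (sin_transform P0 t).
move=> a a' b b'; have := sqr_ge0 (a + a'); have := sqr_ge0 (b + b'); nra.
Qed.

Lemma limit_stat_gt0 (P : probability T R) :
  {ae mu, forall t, 0 < w t} -> ~ same_law P P0 -> (0 < limit_stat P)%E.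
Proof.
move=> w_gt0 PP0.
have dw0 t : 0 <= char_dist P t * w t by rewrite mulr_ge0// addr_ge0// sqr_ge0.
rewrite lt_neqAle integral_ge0 ?andbT; last by move=> t _; rewrite lee_fin.
apply/eqP => /esym dist0.
(* The open set of frequencies at which the characteristic functions differ; it is nonempty by
   uniqueness, and the vanishing integral will make it null. *)
pose U := char_dist P @^-1` [set y | 0 < y].
have oU : open U by move/continuousP: (@continuous_char_dist P); apply; exact: open_gt.
apply: (not_null_open w_density oU).
  apply: contra_notP PP0 => /set0P/negP; rewrite negbK => /eqP U0.
  apply: char_fun_inj => t; rewrite !char_funE.
  have : ~ U t by rewrite U0.
  rewrite /U /= /char_dist /sqr_dist => /negP; rewrite -leNgt.
  move: (cos_transform P t) (cos_transform P0 t) (sin_transform P t) (sin_transform P0 t).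
  move=> a a' b b' ab.
  have /eqP : (a - a') ^+ 2 + (b - b') ^+ 2 = 0.
    by apply/eqP; rewrite eq_le ab addr_ge0// sqr_ge0.
  rewrite paddr_eq0 ?sqr_ge0// !sqrf_eq0 !subr_eq0 => /andP[/eqP-> /eqP->].
  by [].
have mdw : measurable_fun setT (fun t : lebesgue_mx R d p => (char_dist P t * w t)%:E).
  apply/measurable_EFinP; apply: measurable_funM => //.
  exact: measurable_lebesgue_continuous (@continuous_char_dist P).
have ae0 : ae_eq mu setT (fun t => (char_dist P t * w t)%:E) (cst 0%E).
  apply/(ae_eq_integral_abs mu measurableT mdw).
  by under eq_integral => t _ do rewrite gee0_abs ?lee_fin//.
have [N [mN N0 UN]] : mu.-negligible U.
  (* The integrand vanishes almost everywhere, and where [w] is positive this forces the other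
     factor to vanish. *)
  have : {ae mu, forall t, ~ U t}.
    apply: filterS2 ae0 w_gt0 => t /(_ I) /= [dw] wt.
    rewrite /U /=; apply/negP; rewrite -leNgt.
    by move/eqP: dw; rewrite mulf_eq0 (gt_eqF wt) orbF => /eqP ->.
  by apply: negligibleS => t /= Ut; apply.
apply/eqP; rewrite eq_le lebesgue_outer_ge0 andbT -[leRHS]N0.
exact: le_lebesgue_outer.
Qed.

End TestStatistic.
Unset Implicit Arguments.
Set Strict Implicit.

Theorem proposition2p3 (R : realType) (d p : nat) (d_ge1 : (1 <= d)%N)
    (p_ge1 : (1 <= p)%N) (w : 'M[R]_(d, p) -> R)
    (w_density : is_lebesgue_density w)
    (P P0 : probability (borel_mx R d p) R)
    (disp : measure_display) (Omega : measurableType disp)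
    (Pr : probability Omega R) (X : nat -> {RV Pr >-> borel_mx R d p})
    (X_indep : mutually_independent X)
    (X_law : forall j, same_law (distribution Pr (X j)) P) :
  (same_law P P0 ->
   {ae Pr, forall omega,
     test_stat w P0 (fun j => X j omega) n @[n --> \oo] --> 0%E})
  /\
  ({ae @lebesgue_mx_measure R d p, forall t, 0 < w t} ->
   ~ same_law P P0 ->
   exists c : R, 0 < c <= 4 /\
     {ae Pr, forall omega,
       test_stat w P0 (fun j => X j omega) n @[n --> \oo] --> c%:E}).
Proof.
have ae_cvg := ae_empirical_char_cvg X_indep X_law.
split=> [PP0|w_gt0 PP0].
  apply: filterS ae_cvg => omega /(test_stat_cvg w_density (P0 := P0)).
  by rewrite limit_stat_same.
have c_gt0 := limit_stat_gt0 w_density w_gt0 PP0.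
have c_le4 := limit_stat_le4 w_density P0 P.
(* The limit lies between [0] and [4], so it is finite and provides a real constant. *)
have cE : (fine (limit_stat w P0 P))%:E = limit_stat w P0 P.
  by rewrite fineK// ge0_fin_numE ?ltW// (le_lt_trans c_le4)// ltry.
exists (fine (limit_stat w P0 P)); split; first by rewrite -lte_fin -lee_fin cE c_gt0.
by apply: filterS ae_cvg => omega /(test_stat_cvg w_density (P0 := P0)); rewrite cE.
Qed.
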